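(* For every integer $n \geq 5$ and every collection of non-trivial groups $\mathcal{G} = \{G_i \mid i \in \mathbb{Z}/n\mathbb{Z}\}$, $$\mathrm{Out}(C_n\mathcal{G}) \simeq \left( \prod_{i \in \mathbb{Z}/n\mathbb{Z}} \mathrm{Aut}(G_i) \right) \rtimes \mathrm{Sym}.$$
   Context: The cyclic product $C_n\mathcal{G}$ is the graph product of the groups $G_i$ over the cycle $C_n$ with vertex set $\mathbb{Z}/n\mathbb{Z}$ ($i$ adjacent to $i\pm 1$): the quotient of the free product $\ast_{i} G_i$ by the relations $gh=hg$ for all $g\in G_i$, $h\in G_{i+1}$, $i \in \mathbb{Z}/n\mathbb{Z}$. $\mathrm{Out}(G)=\mathrm{Aut}(G)/\mathrm{Inn}(G)$. $\mathrm{Sym}$ is the group of graph automorphisms $\sigma$ of the cycle $C_n$ that preserve the isomorphism classes of the vertex-groups, i.e. $G_{\sigma(i)} \cong G_i$ for all $i$. The semi-direct product is the natural one: fix isomorphisms $\theta_{i,j}: G_i \to G_j$ for all $i,j$ with $G_i\cong G_j$, such that $\theta_{i,i}=\mathrm{id}$ and $\theta_{j,k}\circ\theta_{i,j}=\theta_{i,k}$. An element $\sigma\in\mathrm{Sym}$ acts on $\prod_i \mathrm{Aut}(G_i)$ by $(\sigma\cdot\alpha)_{\sigma(i)} = \theta_{i,\sigma(i)}\circ\alpha_i\circ\theta_{i,\sigma(i)}^{-1}$. *)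

(* Defs.v *)
From HB Require Import structures.
From mathcomp Require Import all_boot ssralg zmodp perm generic_quotient boolp.

Set Implicit Arguments.
Unset Strict Implicit.
Unset Printing Implicit Defensive.

Local Open Scope group_scope.
Local Open Scope quotient_scope.

Record giso (G H : groupType) := GIso {
  giso_fun :> G -> H;
  giso_inv : H -> G;
  gisoM : {morph giso_fun : x y / x * y};
  gisoK : cancel giso_fun giso_inv;
  gisoVK : cancel giso_inv giso_fun }.

HB.instance Definition _ (G H : groupType) (f : giso G H) :=
  isMultiplicative.Build G H (giso_fun f) (@gisoM G H f).

Lemma giso1 (G H : groupType) (f : giso G H) : f 1 = 1.
Proof. by apply: (mulgI (f 1)); rewrite -gisoM !mulg1. Qed.

Lemma gisoV (G H : groupType) (f : giso G H) : {morph f : x / x^-1}.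
Proof. by move=> x; apply: (mulgI (f x)); rewrite -gisoM !mulgV giso1. Qed.

HB.instance Definition _ (G H : groupType) (f : giso G H) :=
  Multiplicative_isUMagmaMorphism.Build G H (giso_fun f) (@giso1 G H f).

Lemma gisoP (G H : groupType) (f g : giso G H) : f =1 g -> f = g.
Proof.
move=> efg; have ef : giso_fun f = giso_fun g by apply/funext.
case: f g ef {efg} => [f f' fM fK f'K] [g g' gM gK g'K] /= efg.
subst g; have ef' : f' = g' by apply/funext => x; rewrite -[LHS]gK f'K.
by subst g'; congr GIso; apply: Prop_irrelevance.
Qed.

Definition isomorphic (G H : groupType) : Prop := inhabited (giso G H).

Definition nontrivial (G : groupType) : Prop := exists g : G, g <> 1.

Definition giso_id (G : groupType) : giso G G :=
  @GIso G G id id (fun _ _ => erefl) (fun _ => erefl) (fun _ => erefl).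

Section IsoOps.
Variables G H K : groupType.

Lemma giso_compM (g : giso H K) (f : giso G H) :
  {morph g \o f : x y / x * y}.
Proof. by move=> x y /=; rewrite !gisoM. Qed.

Definition giso_comp (g : giso H K) (f : giso G H) : giso G K :=
  GIso (giso_compM g f) (can_comp (gisoK g) (gisoK f))
       (can_comp (gisoVK f) (gisoVK g)).

Lemma giso_symM (f : giso G H) : {morph giso_inv f : x y / x * y}.
Proof. by move=> x y; apply: (can_inj (gisoK f)); rewrite gisoM !gisoVK. Qed.

Definition giso_sym (f : giso G H) : giso H G :=
  GIso (giso_symM f) (gisoVK f) (gisoK f).

End IsoOps.

Lemma isomorphic_sym (G H : groupType) : isomorphic G H -> isomorphic H G.
Proof. by case=> f; exact: (inhabits (giso_sym f)). Qed.

Lemma isomorphic_trans (G H K : groupType) :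
  isomorphic G H -> isomorphic H K -> isomorphic G K.
Proof. by move=> [f] [g]; exact: (inhabits (giso_comp g f)). Qed.

Definition AutGroup (G : groupType) := giso G G.

Section AutOps.
Variable G : groupType.
HB.instance Definition _ := gen_eqMixin (AutGroup G).
HB.instance Definition _ := gen_choiceMixin (AutGroup G).

Definition aut_mul (f g : AutGroup G) : AutGroup G := giso_comp f g.
Definition aut_one : AutGroup G := giso_id G.
Definition aut_inv (f : AutGroup G) : AutGroup G := giso_sym f.

Lemma aut_mulA : associative aut_mul.
Proof. by move=> f g h; apply: gisoP. Qed.
Lemma aut_mul1 : left_id aut_one aut_mul.
Proof. by move=> f; apply: gisoP. Qed.
Lemma aut_mulr1 : right_id aut_one aut_mul.
Proof. by move=> f; apply: gisoP. Qed.
Lemma aut_mulV : left_inverse aut_one aut_inv aut_mul.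
Proof. by move=> f; apply: gisoP => x /=; rewrite gisoK. Qed.
Lemma aut_mulrV : right_inverse aut_one aut_inv aut_mul.
Proof. by move=> f; apply: gisoP => x /=; rewrite gisoVK. Qed.

HB.instance Definition _ :=
  isGroup.Build (AutGroup G) aut_mulA aut_mul1 aut_mulr1 aut_mulV aut_mulrV.
End AutOps.

Record normalSubgroup (G : groupType) := NormalSubgroup {
  ns_mem :> G -> Prop;
  ns1 : ns_mem 1;
  nsM : forall x y, ns_mem x -> ns_mem y -> ns_mem (x * y);
  nsV : forall x, ns_mem x -> ns_mem x^-1;
  nsJ : forall x y, ns_mem x -> ns_mem (x ^ y) }.

Section QuotientGroup.
Variables (G : groupType) (N : normalSubgroup G).

Definition ns_rel : rel G := fun x y => `[< N (x^-1 * y) >].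

Lemma ns_rel_refl : reflexive ns_rel.
Proof. by move=> x; apply/asboolP; rewrite mulVg; exact: ns1. Qed.
Lemma ns_rel_sym : symmetric ns_rel.
Proof.
have sub x y : ns_rel x y -> ns_rel y x.
  move/asboolP=> /(@nsV _ N) Nxy; apply/asboolP.
  by rewrite invgM invgK in Nxy.
by move=> x y; apply/idP/idP; exact: sub.
Qed.
Lemma ns_rel_trans : transitive ns_rel.
Proof.
move=> y x z /asboolP Nxy /asboolP Nyz; apply/asboolP.
have -> : x^-1 * z = (x^-1 * y) * (y^-1 * z) by rewrite mulgA mulgK.
exact: nsM.
Qed.

Canonical ns_equiv := EquivRel ns_rel ns_rel_refl ns_rel_sym ns_rel_trans.

Definition quotient_group := {eq_quot ns_equiv}.
HB.instance Definition _ := Choice.on quotient_group.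
HB.instance Definition _ := EqQuotient.on quotient_group.

Definition coset_mul := lift_op2 quotient_group (@mul G).
Definition coset_inv := lift_op1 quotient_group (@inv G).
Definition coset_one : quotient_group := \pi 1.

Lemma ns_repr x : N (x^-1 * repr (\pi_quotient_group x)).
Proof.
have /eqmodP /= /asboolP // : x = repr (\pi_quotient_group x)
  %[mod_eq ns_equiv] by rewrite reprK.
Qed.

Lemma pi_coset_mul : {morph \pi_quotient_group : x y / x * y >-> coset_mul x y}.
Proof.
move=> x y; unlock coset_mul; apply/eqmodP/asboolP.
set x' := repr (\pi x); set y' := repr (\pi y).
have -> : (x * y)^-1 * (x' * y') = (x^-1 * x') ^ y * (y^-1 * y').
  by rewrite /conjg invgM !mulgA mulgK.
by apply: nsM; [apply: nsJ|]; exact: ns_repr.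
Qed.

Lemma pi_coset_inv : {morph \pi_quotient_group : x / x^-1 >-> coset_inv x}.
Proof.
move=> x; unlock coset_inv; apply/eqmodP/asboolP.
set x' := repr (\pi x).
have -> : x^-1^-1 * x'^-1 = ((x^-1 * x')^-1) ^ x^-1.
  by rewrite /conjg invgM !invgK !mulgA mulgK.
by apply: nsJ; apply: nsV; exact: ns_repr.
Qed.

Lemma coset_mulA : associative coset_mul.
Proof. by elim/quotW=> x; elim/quotW=> y; elim/quotW=> z;
  rewrite -!pi_coset_mul mulgA. Qed.
Lemma coset_mul1 : left_id coset_one coset_mul.
Proof. by elim/quotW=> x; rewrite /coset_one -pi_coset_mul mul1g. Qed.
Lemma coset_mulr1 : right_id coset_one coset_mul.
Proof. by elim/quotW=> x; rewrite /coset_one -pi_coset_mul mulg1. Qed.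
Lemma coset_mulV : left_inverse coset_one coset_inv coset_mul.
Proof.
by elim/quotW=> x; rewrite -pi_coset_inv -pi_coset_mul mulVg.
Qed.
Lemma coset_mulrV : right_inverse coset_one coset_inv coset_mul.
Proof.
by elim/quotW=> x; rewrite -pi_coset_inv -pi_coset_mul mulgV.
Qed.

HB.instance Definition _ := isGroup.Build quotient_group
  coset_mulA coset_mul1 coset_mulr1 coset_mulV coset_mulrV.

Definition quot_proj (x : G) : quotient_group := \pi x.

Lemma quot_projM : {morph quot_proj : x y / x * y}.
Proof. exact: pi_coset_mul. Qed.
HB.instance Definition _ :=
  isMultiplicative.Build G quotient_group quot_proj quot_projM.

Lemma quot_proj_eq (x y : G) :
  quot_proj x = quot_proj y <-> N (x^-1 * y).
Proof.
by split=> [/eqmodP/asboolP // | Nxy]; apply/eqmodP; apply/asboolP.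
Qed.

End QuotientGroup.

Section NormalClosure.
Variables (G : groupType) (S : G -> Prop).

Definition normal_closure_mem (x : G) : Prop :=
  forall N : normalSubgroup G, (forall s, S s -> N s) -> N x.

Lemma nc1 : normal_closure_mem 1.
Proof. by move=> N _; exact: ns1. Qed.
Lemma ncM x y : normal_closure_mem x -> normal_closure_mem y ->
  normal_closure_mem (x * y).
Proof. by move=> hx hy N SN; apply: nsM; [apply: hx | apply: hy]. Qed.
Lemma ncV x : normal_closure_mem x -> normal_closure_mem x^-1.
Proof. by move=> hx N SN; apply: nsV; apply: hx. Qed.
Lemma ncJ x y : normal_closure_mem x -> normal_closure_mem (x ^ y).
Proof. by move=> hx N SN; apply: nsJ; apply: hx. Qed.

Definition normal_closure : normalSubgroup G := NormalSubgroup nc1 ncM ncV ncJ.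
End NormalClosure.

Section Outer.
Variable G : groupType.

Definition inner_mem (f : AutGroup G) : Prop :=
  exists g : G, forall x, f x = g * x * g^-1.

Lemma inner1 : inner_mem 1.
Proof. by exists 1 => x; rewrite invg1 mul1g mulg1. Qed.
Lemma innerM f1 f2 : inner_mem f1 -> inner_mem f2 -> inner_mem (f1 * f2).
Proof.
move=> [g1 e1] [g2 e2]; exists (g1 * g2) => x.
rewrite -[(f1 * f2) x]/(f1 (f2 x)) e1 e2 invgM !mulgA //.
Qed.
Lemma innerV f : inner_mem f -> inner_mem f^-1.
Proof.
move=> [g e]; exists g^-1 => x; apply: (can_inj (gisoK f)).
rewrite -[f^-1 x]/(giso_inv f x) gisoVK e.
by rewrite invgK !mulgA mulgV mul1g mulgK.
Qed.
Lemma innerJ f a : inner_mem f -> inner_mem (f ^ a).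
Proof.
move=> [g e]; exists (giso_inv a g) => x; apply: (can_inj (gisoK a)).
rewrite -[(f ^ a) x]/(giso_inv a (f (a x))) gisoVK e !gisoM gisoVK.
by rewrite gisoV gisoVK.
Qed.

Definition InnGroup : normalSubgroup (AutGroup G) :=
  NormalSubgroup inner1 innerM innerV innerJ.

Definition OutGroup : groupType := quotient_group InnGroup.
End Outer.

(* Free products: words in the disjoint union of the G i, modulo the
   congruence that deletes trivial letters and multiplies adjacent letters
   coming from the same group. *)

Section FreeProduct.
Variables (I : choiceType) (G : I -> groupType).

Definition letter := {i : I & G i}.
Definition lett (i : I) (g : G i) : letter := Tagged (fun i => G i) g.

Inductive fp_equiv : seq letter -> seq letter -> Prop :=
| fp_one u v i : fp_equiv (u ++ lett (1 : G i) :: v) (u ++ v)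
| fp_mul u v i (g h : G i) :
    fp_equiv (u ++ lett g :: lett h :: v) (u ++ lett (g * h) :: v)
| fp_refl u : fp_equiv u u
| fp_sym u v : fp_equiv u v -> fp_equiv v u
| fp_trans u v w : fp_equiv u v -> fp_equiv v w -> fp_equiv u w.

Definition fp_rel : rel (seq letter) := fun u v => `[< fp_equiv u v >].

Lemma fp_rel_refl : reflexive fp_rel.
Proof. by move=> u; apply/asboolP; exact: fp_refl. Qed.
Lemma fp_rel_sym : symmetric fp_rel.
Proof. by move=> u v; apply/asboolP/asboolP; exact: fp_sym. Qed.
Lemma fp_rel_trans : transitive fp_rel.
Proof.
move=> v u w /asboolP uv /asboolP vw; apply/asboolP; exact: fp_trans uv vw.
Qed.

Canonical fp_equiv_rel := EquivRel fp_rel fp_rel_refl fp_rel_sym fp_rel_trans.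

Definition free_product := {eq_quot fp_equiv_rel}.
HB.instance Definition _ := Choice.on free_product.
HB.instance Definition _ := EqQuotient.on free_product.

Lemma fp_equiv_cat u u' v v' :
  fp_equiv u u' -> fp_equiv v v' -> fp_equiv (u ++ v) (u' ++ v').
Proof.
move=> uu' vv'; apply: (@fp_trans _ (u' ++ v)).
  elim: uu' => {u u' v' vv'} [a b i|a b i g h|a|a b _|a b c _ ab _ bc].
  - by rewrite -!catA; exact: fp_one.
  - by rewrite -!catA; exact: fp_mul.
  - exact: fp_refl.
  - exact: fp_sym.
  - exact: fp_trans ab bc.
elim: vv' => {u uu' v v'} [a b i|a b i g h|a|a b _|a b c _ ab _ bc].
- by rewrite !catA; exact: fp_one.
- by rewrite !catA; exact: fp_mul.
- exact: fp_refl.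
- exact: fp_sym.
- exact: fp_trans ab bc.
Qed.

Definition word_inv (u : seq letter) : seq letter :=
  rev [seq lett (tagged x : G (tag x))^-1 | x : letter <- u].

Lemma word_inv_cat u v : word_inv (u ++ v) = word_inv v ++ word_inv u.
Proof. by rewrite /word_inv map_cat rev_cat. Qed.

Lemma word_invK : involutive word_inv.
Proof.
move=> u; rewrite /word_inv map_rev revK -map_comp.
by rewrite -[RHS]map_id; apply: eq_map => -[i g] /=; rewrite /lett /= invgK.
Qed.

Lemma word_inv_equiv u v : fp_equiv u v -> fp_equiv (word_inv u) (word_inv v).
Proof.
elim=> {u v} [a b i|a b i g h|a|a b _|a b c _ ab _ bc].
- rewrite !word_inv_cat -cat1s word_inv_cat -catA /= /word_inv /= invg1.
  exact: fp_one.
- rewrite !word_inv_cat -[lett g :: _]cat1s -[lett h :: _]cat1s.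
  rewrite -[lett (g * h) :: _]cat1s !word_inv_cat -!catA /word_inv /= invgM.
  exact: fp_mul.
- exact: fp_refl.
- exact: fp_sym.
- exact: fp_trans ab bc.
Qed.

Lemma word_mulV u : fp_equiv (u ++ word_inv u) [::].
Proof.
elim: u => [|[i g] u IH]; first exact: fp_refl.
rewrite -[existT _ _ _ :: u]cat1s word_inv_cat -!catA [u ++ _]catA.
apply: (@fp_trans _ ([:: lett (g : G i)] ++ [::] ++ word_inv [:: lett (g : G i)])).
  apply: fp_equiv_cat; first exact: fp_refl.
  by apply: fp_equiv_cat; last exact: fp_refl.
apply: fp_trans (fp_mul [::] [::] g g^-1) _.
by rewrite mulgV; exact: fp_one.
Qed.

Definition fprod_mul := lift_op2 free_product cat.
Definition fprod_inv := lift_op1 free_product word_inv.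
Definition fprod_one : free_product := \pi [::].

Lemma fp_equiv_repr u : fp_equiv u (repr (\pi_free_product u)).
Proof.
have /eqmodP /= /asboolP // : u = repr (\pi_free_product u)
  %[mod_eq fp_equiv_rel] by rewrite reprK.
Qed.

Lemma pi_fprod_mul : {morph \pi_free_product : u v / u ++ v >-> fprod_mul u v}.
Proof.
move=> u v; unlock fprod_mul; apply/eqmodP/asboolP.
by apply: fp_equiv_cat; exact: fp_equiv_repr.
Qed.

Lemma pi_fprod_inv : {morph \pi_free_product : u / word_inv u >-> fprod_inv u}.
Proof.
move=> u; unlock fprod_inv; apply/eqmodP/asboolP.
by apply: word_inv_equiv; exact: fp_equiv_repr.
Qed.

Lemma fprod_mulA : associative fprod_mul.
Proof. by elim/quotW=> u; elim/quotW=> v; elim/quotW=> w;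
  rewrite -!pi_fprod_mul catA. Qed.
Lemma fprod_mul1 : left_id fprod_one fprod_mul.
Proof. by elim/quotW=> u; rewrite /fprod_one -pi_fprod_mul. Qed.
Lemma fprod_mulr1 : right_id fprod_one fprod_mul.
Proof. by elim/quotW=> u; rewrite /fprod_one -pi_fprod_mul cats0. Qed.
Lemma fprod_mulrV : right_inverse fprod_one fprod_inv fprod_mul.
Proof.
elim/quotW=> u; rewrite -pi_fprod_inv -pi_fprod_mul.
by apply/eqmodP/asboolP; exact: word_mulV.
Qed.
Lemma fprod_mulV : left_inverse fprod_one fprod_inv fprod_mul.
Proof.
elim/quotW=> u; rewrite -pi_fprod_inv -pi_fprod_mul.
apply/eqmodP/asboolP; rewrite -[X in _ ++ X]word_invK; exact: word_mulV.
Qed.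

HB.instance Definition _ := isGroup.Build free_product
  fprod_mulA fprod_mul1 fprod_mulr1 fprod_mulV fprod_mulrV.

Definition fprod_inj (i : I) (g : G i) : free_product := \pi [:: lett g].

Lemma fprod_injM i : {morph @fprod_inj i : g h / g * h}.
Proof.
move=> g h; rewrite -[RHS]/(fprod_mul _ _) /fprod_inj -pi_fprod_mul.
by apply/eqmodP/asboolP/fp_sym; exact: (fp_mul [::] [::]).
Qed.
HB.instance Definition _ i :=
  isMultiplicative.Build (G i) free_product (@fprod_inj i) (@fprod_injM i).

End FreeProduct.

Section GraphProduct.
Variables (V : choiceType) (adj : rel V) (G : V -> groupType).

Definition graph_relator (x : free_product G) : Prop :=
  exists (i j : V) (g : G i) (h : G j),
    adj i j /\ x = [~ fprod_inj g, fprod_inj h].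

Definition graph_product : groupType :=
  quotient_group (normal_closure graph_relator).
End GraphProduct.

Definition cycle_adj (n : nat) : rel 'Z_n :=
  fun i j => (j == i + 1)%R || (i == j + 1)%R.

Definition cyclic_product (n : nat) (G : 'Z_n -> groupType) : groupType :=
  graph_product (@cycle_adj n) G.

Section SymOps.
Variables (V : finType) (adj : rel V) (G : V -> groupType).

Record SymGroup := MkSym {
  sym_perm :> {perm V};
  sym_adj : forall i j, adj (sym_perm i) (sym_perm j) = adj i j;
  sym_isom : forall i, isomorphic (G (sym_perm i)) (G i) }.

HB.instance Definition _ := gen_eqMixin SymGroup.
HB.instance Definition _ := gen_choiceMixin SymGroup.

Lemma symP (s t : SymGroup) : s =1 t -> s = t.
Proof.
move=> est; have {est} : sym_perm s = sym_perm t by apply/permP.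
case: s t => [s sa si] [t ta ti] /= est; subst t.
by congr MkSym; apply: Prop_irrelevance.
Qed.

(* The product of {perm V} is (s * t) i = t (s i); SymGroup carries the opposite
   product, namely the composition of maps, so that it acts on the left. *)
Section Ops.
Variables s t : SymGroup.

Lemma sym_mul_adj i j : adj ((sym_perm t * sym_perm s) i) ((sym_perm t * sym_perm s) j)
  = adj i j.
Proof. by rewrite !permM !sym_adj. Qed.
Lemma sym_mul_isom i : isomorphic (G ((sym_perm t * sym_perm s) i)) (G i).
Proof.
rewrite permM; exact: isomorphic_trans (sym_isom s _) (sym_isom t _).
Qed.
Definition sym_mul : SymGroup := MkSym sym_mul_adj sym_mul_isom.

Lemma sym_inv_adj i j :
  adj ((sym_perm s)^-1 i) ((sym_perm s)^-1 j) = adj i j.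
Proof. by rewrite -(sym_adj s) !permKV. Qed.
Lemma sym_inv_isom i : isomorphic (G ((sym_perm s)^-1 i)) (G i).
Proof.
by apply: isomorphic_sym; have := sym_isom s ((sym_perm s)^-1 i); rewrite permKV.
Qed.
Definition sym_inv : SymGroup := MkSym sym_inv_adj sym_inv_isom.
End Ops.

Lemma sym_one_adj i j : adj ((1 : {perm V}) i) ((1 : {perm V}) j) = adj i j.
Proof. by rewrite !perm1. Qed.
Lemma sym_one_isom i : isomorphic (G ((1 : {perm V}) i)) (G i).
Proof. by rewrite perm1; exact: (inhabits (giso_id _)). Qed.
Definition sym_one : SymGroup := MkSym sym_one_adj sym_one_isom.

Lemma sym_mulA : associative sym_mul.
Proof. by move=> s t u; apply: symP => i /=; rewrite !permM. Qed.
Lemma sym_mul1 : left_id sym_one sym_mul.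
Proof. by move=> s; apply: symP => i /=; rewrite permM perm1. Qed.
Lemma sym_mulr1 : right_id sym_one sym_mul.
Proof. by move=> s; apply: symP => i /=; rewrite permM perm1. Qed.
Lemma sym_mulV : left_inverse sym_one sym_inv sym_mul.
Proof. by move=> s; apply: symP => i /=; rewrite permM permK perm1. Qed.
Lemma sym_mulrV : right_inverse sym_one sym_inv sym_mul.
Proof. by move=> s; apply: symP => i /=; rewrite permM permKV perm1. Qed.

HB.instance Definition _ :=
  isGroup.Build SymGroup sym_mulA sym_mul1 sym_mulr1 sym_mulV sym_mulrV.

End SymOps.

Section DirectProduct.
Variables (I : Type) (G : I -> groupType).

Definition direct_product := forall i, G i.
HB.instance Definition _ := Choice.on direct_product.

Definition dp_mul (a b : direct_product) : direct_product :=
  fun i => a i * b i.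
Definition dp_one : direct_product := fun=> 1.
Definition dp_inv (a : direct_product) : direct_product := fun i => (a i)^-1.

Lemma dp_mulA : associative dp_mul.
Proof. by move=> a b c; apply: functional_extensionality_dep => i; exact: mulgA. Qed.
Lemma dp_mul1 : left_id dp_one dp_mul.
Proof. by move=> a; apply: functional_extensionality_dep => i; exact: mul1g. Qed.
Lemma dp_mulr1 : right_id dp_one dp_mul.
Proof. by move=> a; apply: functional_extensionality_dep => i; exact: mulg1. Qed.
Lemma dp_mulV : left_inverse dp_one dp_inv dp_mul.
Proof. by move=> a; apply: functional_extensionality_dep => i; exact: mulVg. Qed.
Lemma dp_mulrV : right_inverse dp_one dp_inv dp_mul.
Proof. by move=> a; apply: functional_extensionality_dep => i; exact: mulgV. Qed.

HB.instance Definition _ := isGroup.Build direct_product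
  dp_mulA dp_mul1 dp_mulr1 dp_mulV dp_mulrV.
End DirectProduct.

Record semidirect (N H : groupType) (phi : {multiplicative H -> AutGroup N}) :=
  Semidirect { sd_left : N; sd_right : H }.
Arguments semidirect {N H} phi.

Section Semidirect.
Variables (N H : groupType) (phi : {multiplicative H -> AutGroup N}).
Local Notation sd := (semidirect phi).
Local Notation mk := (@Semidirect N H phi).

HB.instance Definition _ := gen_eqMixin sd.
HB.instance Definition _ := gen_choiceMixin sd.

Definition sd_mul (x y : sd) : sd :=
  mk (sd_left x * phi (sd_right x) (sd_left y)) (sd_right x * sd_right y).
Definition sd_one : sd := mk 1 1.
Definition sd_inv (x : sd) : sd :=
  mk (phi (sd_right x)^-1 (sd_left x)^-1) (sd_right x)^-1.

Lemma phi_comp h k x : phi (h * k) x = phi h (phi k x).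
Proof. by rewrite gmulfM. Qed.
Lemma phi_one x : phi 1 x = x.
Proof.
by apply: (can_inj (gisoK (phi 1))); rewrite -phi_comp mulg1.
Qed.
Lemma phi_fix1 h : phi h 1 = 1.
Proof. exact: giso1. Qed.

Lemma sd_mulA : associative sd_mul.
Proof.
by move=> x y z; rewrite /sd_mul /= gisoM phi_comp !mulgA.
Qed.
Lemma sd_mul1 : left_id sd_one sd_mul.
Proof. by case=> x h; rewrite /sd_mul /= phi_one !mul1g. Qed.
Lemma sd_mulr1 : right_id sd_one sd_mul.
Proof. by case=> x h; rewrite /sd_mul /= phi_fix1 !mulg1. Qed.
Lemma sd_mulV : left_inverse sd_one sd_inv sd_mul.
Proof. by case=> x h; rewrite /sd_mul /= -gisoM !mulVg phi_fix1. Qed.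
Lemma sd_mulrV : right_inverse sd_one sd_inv sd_mul.
Proof. by case=> x h; rewrite /sd_mul /= -phi_comp !mulgV phi_one mulgV. Qed.

HB.instance Definition _ := isGroup.Build sd
  sd_mulA sd_mul1 sd_mulr1 sd_mulV sd_mulrV.
End Semidirect.

(* The field theta is only asked for when G i and G j are isomorphic; its value
   does not depend on the proof of that fact, by proof irrelevance. *)
Record iso_system (I : Type) (G : I -> groupType) := IsoSystem {
  theta : forall i j, isomorphic (G i) (G j) -> giso (G i) (G j);
  theta_id : forall i (p : isomorphic (G i) (G i)) x, theta p x = x;
  theta_comp : forall i j k (p : isomorphic (G i) (G j))
    (q : isomorphic (G j) (G k)) (r : isomorphic (G i) (G k)) x,
    theta q (theta p x) = theta r x }.

Lemma iso_system_exists (I : choiceType) (G : I -> groupType) :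
  inhabited (iso_system G).
Proof.
pose cls i : pred I := fun j => `[< isomorphic (G j) (G i) >].
have clsi i : exists j, cls i j.
  by exists i; apply/asboolP; exact: (inhabits (giso_id _)).
pose r i := xchoose (clsi i).
have rP i : isomorphic (G (r i)) (G i) by apply/asboolP; exact: (xchooseP (clsi i)).
have rE i j : isomorphic (G i) (G j) -> r i = r j.
  move=> p; apply: eq_xchoose => k; apply/asboolP/asboolP => q.
    exact: isomorphic_trans q p.
  exact: isomorphic_trans q (isomorphic_sym p).
have h i : giso (G (r i)) (G i) by apply: (inhabited_witness (rP i)).
pose cast k l (e : k = l) : giso (G k) (G l) :=
  eq_rect k (fun l => giso (G k) (G l)) (giso_id _) l e.
pose th i j p := giso_comp (h j) (giso_comp (cast _ _ (rE i j p)) (giso_sym (h i))).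
have castE k (e : k = k) x : cast k k e x = x by rewrite (Prop_irrelevance e erefl).
have castC k l m (e : k = l) (f : l = m) (g : k = m) x :
  cast _ _ f (cast _ _ e x) = cast _ _ g x.
  by subst l; subst m; rewrite !castE.
constructor; exists th => [i p x|i j k p q s x] /=.
  by rewrite castE gisoVK.
by rewrite gisoK (castC _ _ _ _ _ (rE i k s)).
Qed.

(* sigma acts on the product of the Aut (G i): at the vertex j the result is
   the conjugate of alpha_i by theta_{i,j}, with i = sigma^-1 j.  The form
   (sigma . alpha)_{sigma i} = theta_{i,sigma i} alpha_i theta_{i,sigma i}^-1
   is sym_act_perm. *)

Section SymAction.
Variables (V : finType) (adj : rel V) (G : V -> groupType).
Variable Theta : iso_system G.

Definition aut_product : groupType := direct_product (fun i => AutGroup (G i)).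

Definition conj_iso (K L : groupType) (t : giso K L) (a : AutGroup K) :
    AutGroup L :=
  giso_comp t (giso_comp a (giso_sym t)).

Definition sym_act_fun (s : SymGroup adj G) (a : aut_product) : aut_product :=
  fun j => conj_iso (theta Theta (sym_isom s^-1 j)) (a ((s^-1 : SymGroup adj G) j)).

Lemma sym_actE (s : SymGroup adj G) (a : aut_product) i j
    (p : isomorphic (G i) (G j)) :
  s i = j -> sym_act_fun s a j = conj_iso (theta Theta p) (a i).
Proof.
move=> sij; have ji : (s^-1 : SymGroup adj G) j = i.
  by rewrite -sij; exact: permK.
subst i; rewrite /sym_act_fun; congr (conj_iso (theta _ _) _).
exact: Prop_irrelevance.
Qed.

Lemma sym_act_perm (s : SymGroup adj G) (a : aut_product) (i : V)
    (p : isomorphic (G i) (G (s i))) :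
  sym_act_fun s a (s i) = conj_iso (theta Theta p) (a i).
Proof. exact: sym_actE. Qed.

Lemma theta_invE i j (p : isomorphic (G i) (G j)) (q : isomorphic (G j) (G i)) :
  giso_inv (theta Theta p) =1 theta Theta q.
Proof.
move=> x; apply: (can_inj (gisoK (theta Theta p))).
by rewrite gisoVK (theta_comp _ _ _ (inhabits (giso_id _))) theta_id.
Qed.

Lemma sym_act_funM s : {morph sym_act_fun s : a b / a * b}.
Proof.
move=> a b; apply: functional_extensionality_dep => j; apply: gisoP => x.
by rewrite /= gisoK.
Qed.

Lemma sym_act_fun1 a : sym_act_fun 1 a = a.
Proof.
apply: functional_extensionality_dep => j.
have p : isomorphic (G j) (G j) by exact: (inhabits (giso_id _)).
rewrite (sym_actE _ p); last exact: perm1.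
by apply: gisoP => x; rewrite /= theta_id (theta_invE p p) theta_id.
Qed.

Lemma sym_act_fun_comp s t a :
  sym_act_fun (s * t) a = sym_act_fun s (sym_act_fun t a).
Proof.
apply: functional_extensionality_dep => j.
pose k := (s^-1 : SymGroup adj G) j; pose i := (t^-1 : SymGroup adj G) k.
have sk : s k = j by exact: permKV.
have ti : t i = k by exact: permKV.
have p : isomorphic (G i) (G k) by exact: sym_isom.
have q : isomorphic (G k) (G j) by exact: sym_isom.
have r := isomorphic_trans p q.
rewrite (sym_actE _ q sk) (sym_actE _ p ti) (sym_actE _ r); last first.
  by rewrite -sk -ti; exact: permM.
apply: gisoP => x /=.
rewrite (theta_invE r (isomorphic_sym r)) (theta_invE q (isomorphic_sym q)).
rewrite (theta_invE p (isomorphic_sym p)) (theta_comp _ _ _ r).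
by rewrite (theta_comp _ _ _ (isomorphic_sym r)).
Qed.

Lemma sym_actK s : cancel (sym_act_fun s) (sym_act_fun s^-1).
Proof. by move=> a; rewrite -sym_act_fun_comp mulVg sym_act_fun1. Qed.
Lemma sym_actVK s : cancel (sym_act_fun s^-1) (sym_act_fun s).
Proof. by move=> a; rewrite -sym_act_fun_comp mulgV sym_act_fun1. Qed.

Definition sym_act (s : SymGroup adj G) : AutGroup aut_product :=
  GIso (sym_act_funM s) (sym_actK s) (sym_actVK s).

Lemma sym_actM : {morph sym_act : s t / s * t}.
Proof. by move=> s t; apply: gisoP => a; exact: sym_act_fun_comp. Qed.

HB.instance Definition _ := isMultiplicative.Build
  (SymGroup adj G) (AutGroup aut_product) sym_act sym_actM.
End SymAction.
Arguments sym_act {V} adj {G} Theta s.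

(* Main.v *)
From HB Require Import structures.
Require Import Defs.
From mathcomp Require Import all_boot ssralg zmodp perm generic_quotient boolp.

(* Words over the vertex groups label the edge paths of the Cayley graph, and each
   coset x<star(i)> is a wall: the edge from x to xs, with s in G_i, crosses only
   that wall.  A path of minimal length crosses no wall twice and every wall that
   it crosses separates its ends.  Walls are detected by the function giving the
   G_i-syllable with which a reduced word for x can begin.

   From walls one gets the intersection of two conjugates of star subgroups, the
   centralizers of the nontrivial elements of star subgroups, and, for any other
   element a, the fact that every b commuting with a has a power in <a>: b moves
   the walls crossed by the axis of a, which are finite in number modulo a.  Hence
   every subgroup AB, with commuting nontrivial A, B and A /\ B = 1, lies in a
   conjugate of a star subgroup, so that an automorphism f permutes the
   conjugates of star subgroups.

   The stars of adjacent vertices i, j are sent to subgroups with a common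
   conjugator, since f(G_i x G_j) is not inside a conjugate of a vertex group.
   For three consecutive vertices a ping-pong argument in G_p * G_q, using that
   the images generate, again gives a common conjugator, and shows that f induces
   on the vertices of the cycle a map without backtracking, i.e. a rotation or a
   reflection sigma.  Successive conjugators d_i can be chosen such that
   d_i^-1 d_(i+1) lies in G_(sigma i).  Going around the cycle, these n elements
   of distinct vertex groups have product 1, so all of them are trivial: up to an
   inner automorphism, f maps each G_i onto G_(sigma i). *)

Set Implicit Arguments.
Unset Strict Implicit.
Unset Printing Implicit Defensive.

Import GRing.Theory.
Local Open Scope group_scope.
Local Open Scope quotient_scope.

(** * Homomorphisms out of a graph product *)

Lemma morph_mulg1 (G H : groupType) (f : G -> H) :
  {morph f : x y / x * y} -> f 1 = 1.
Proof. by move=> fM; apply: (mulgI (f 1)); rewrite -fM !mulg1. Qed.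

Lemma morph_mulgV (G H : groupType) (f : G -> H) :
  {morph f : x y / x * y} -> {morph f : x / x^-1}.
Proof.
by move=> fM x; apply: (mulgI (f x)); rewrite -fM !mulgV morph_mulg1.
Qed.

Lemma morph_commg (G H : groupType) (f : G -> H) :
  {morph f : x y / x * y} -> {morph f : x y / [~ x, y]}.
Proof.
by move=> fM x y; rewrite /commg /conjg !fM !(morph_mulgV fM).
Qed.

Section Kernel.
Variables (G H : groupType) (f : G -> H).
Hypothesis fM : {morph f : x y / x * y}.

Lemma morph_kerM x y : f x = 1 -> f y = 1 -> f (x * y) = 1.
Proof. by rewrite fM => -> ->; rewrite mulg1. Qed.

Lemma morph_kerV x : f x = 1 -> f x^-1 = 1.
Proof. by rewrite (morph_mulgV fM) => ->; rewrite invg1. Qed.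

Lemma morph_kerJ x y : f x = 1 -> f (x ^ y) = 1.
Proof.
by rewrite /conjg !fM (morph_mulgV fM) => ->; rewrite mul1g mulVg.
Qed.

Definition morph_ker : normalSubgroup G :=
  NormalSubgroup (morph_mulg1 fM) morph_kerM morph_kerV morph_kerJ.
End Kernel.

Section QuotientLift.
Variables (G H : groupType) (N : normalSubgroup G) (f : G -> H).
Hypothesis fM : {morph f : x y / x * y}.
Hypothesis fN : forall x, N x -> f x = 1.

Definition quot_lift (x : quotient_group N) : H := f (repr x).

Lemma quot_liftE x : quot_lift (quot_proj N x) = f x.
Proof.
have /fN := @ns_repr G N x; rewrite fM (morph_mulgV fM) => /mulg1_eq.
by rewrite invgK.
Qed.

Lemma quot_projP (y : quotient_group N) : exists x, y = quot_proj N x.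
Proof. by exists (repr y); rewrite /quot_proj reprK. Qed.

Lemma quot_liftM : {morph quot_lift : x y / x * y}.
Proof.
move=> x y; case: (quot_projP x) => a ->; case: (quot_projP y) => b ->.
by rewrite -(quot_projM N) !quot_liftE fM.
Qed.
End QuotientLift.

Section FreeProductLift.
Variables (I : choiceType) (G : I -> groupType) (H : groupType).
Variable f : forall i, G i -> H.
Hypothesis fM : forall i, {morph @f i : g h / g * h}.

Definition word_eval (w : seq (letter G)) : H :=
  foldr (fun l x => f (tagged l) * x) 1 w.

Lemma word_eval_cat u v : word_eval (u ++ v) = word_eval u * word_eval v.
Proof. by elim: u => [|l u IH] /=; rewrite ?mul1g // IH mulgA. Qed.

Lemma word_eval_equiv u v : fp_equiv u v -> word_eval u = word_eval v.
Proof.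
elim=> {u v} [u v i|u v i g h|u|u v _ ->|u v w _ -> _ ->] //.
  by rewrite !word_eval_cat /= (morph_mulg1 (@fM i)) mul1g.
by rewrite !word_eval_cat /= fM -!mulgA.
Qed.

Definition fprod_lift (x : free_product G) : H := word_eval (repr x).

Lemma fprod_lift_pi w : fprod_lift (\pi_(free_product G) w) = word_eval w.
Proof. by apply/esym/word_eval_equiv/fp_equiv_repr. Qed.

Lemma fprod_liftM : {morph fprod_lift : x y / x * y}.
Proof.
move=> x y; rewrite -[x]reprK -[y]reprK; move: (repr x) (repr y) => u v.
rewrite -[_ * _]/(fprod_mul _ _) -pi_fprod_mul.
by rewrite !fprod_lift_pi word_eval_cat.
Qed.

Lemma fprod_liftE i (g : G i) : fprod_lift (fprod_inj g) = f g.
Proof. by rewrite fprod_lift_pi /= mulg1. Qed.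
End FreeProductLift.

Section GraphProductLift.
Variables (V : choiceType) (adj : rel V) (G : V -> groupType).
Local Notation Gam := (graph_product adj G).

Definition gp_inj (i : V) (g : G i) : Gam := quot_proj _ (fprod_inj g).

Lemma gp_injM i : {morph @gp_inj i : g h / g * h}.
Proof. by move=> g h; rewrite /gp_inj (fprod_injM g h) (quot_projM _). Qed.

Lemma gp_inj_commute i j (g : G i) (h : G j) :
  adj i j -> commute (gp_inj g) (gp_inj h).
Proof.
set N := normal_closure (@graph_relator V adj G); move=> ij.
apply/commgP/eqP; rewrite /gp_inj -(morph_commg (quot_projM N)).
rewrite -(morph_mulg1 (quot_projM N)); apply/esym/quot_proj_eq.
by rewrite invg1 mul1g => M; apply; exists i, j, g, h.
Qed.

Lemma gp_inj_ind (P : Gam -> Prop) :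
  P 1 -> (forall i (g : G i) x, P x -> P (gp_inj g * x)) -> forall x, P x.
Proof.
move=> P1 PM x; case: (quot_projP x) => a ->; elim/quotW: a => w.
elim: w => [|[i g] w IH].
  have -> : \pi_(free_product G) [::] = 1 by [].
  by rewrite (morph_mulg1 (quot_projM _)).
have -> : \pi_(free_product G) (existT _ i g :: w) =
    fprod_inj (g : G i) * \pi_(free_product G) w.
  by rewrite -[RHS]/(fprod_mul _ _) /fprod_inj -pi_fprod_mul.
by rewrite (quot_projM _); apply: PM.
Qed.

Variables (H : groupType) (f : forall i, G i -> H).
Hypothesis fM : forall i, {morph @f i : g h / g * h}.
Hypothesis fC : forall i j (g : G i) (h : G j), adj i j -> commute (f g) (f h).

Lemma fprod_lift_closure x :
  normal_closure (@graph_relator V adj G) x -> fprod_lift f x = 1.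
Proof.
have FM := fprod_liftM fM; move=> /(_ (morph_ker FM)).
apply=> _ [i] [j] [g] [h] [ij ->] /=.
rewrite (morph_commg FM) !(fprod_liftE fM).
exact/eqP/commgP/fC.
Qed.

Definition gp_lift : Gam -> H := quot_lift (fprod_lift f).

Lemma gp_liftM : {morph gp_lift : x y / x * y}.
Proof. exact: quot_liftM (fprod_liftM fM) fprod_lift_closure. Qed.

Lemma gp_liftE i (g : G i) : gp_lift (gp_inj g) = f g.
Proof.
rewrite /gp_lift (quot_liftE (fprod_liftM fM) fprod_lift_closure).
exact: fprod_liftE.
Qed.
End GraphProductLift.

(** * The action on pilings *)

Section SelfBijections.
Variable X : Type.

Record bijection := Bijection {
  bij_fun :> X -> X;
  bij_inv : X -> X;
  bijK : cancel bij_fun bij_inv;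
  bijVK : cancel bij_inv bij_fun }.

Lemma bijectionP (f g : bijection) : f =1 g -> f = g.
Proof.
case: f g => [f f' fK f'K] [g g' gK g'K] /= efg.
have ? : f = g by apply/funext.
subst g; have ? : f' = g' by apply/funext => x; rewrite -[LHS]gK f'K.
by subst g'; congr Bijection; apply: Prop_irrelevance.
Qed.

HB.instance Definition _ := gen_eqMixin bijection.
HB.instance Definition _ := gen_choiceMixin bijection.

Definition bij_mul (f g : bijection) : bijection :=
  Bijection (can_comp (bijK f) (bijK g)) (can_comp (bijVK g) (bijVK f)).
Definition bij_one : bijection :=
  @Bijection id id (fun=> erefl) (fun=> erefl).
Definition bij_opp (f : bijection) : bijection := Bijection (bijVK f) (bijK f).

Lemma bij_mulA : associative bij_mul.
Proof. by move=> f g h; apply: bijectionP. Qed.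
Lemma bij_mul1 : left_id bij_one bij_mul.
Proof. by move=> f; apply: bijectionP. Qed.
Lemma bij_mulr1 : right_id bij_one bij_mul.
Proof. by move=> f; apply: bijectionP. Qed.
Lemma bij_mulV : left_inverse bij_one bij_opp bij_mul.
Proof. by move=> f; apply: bijectionP => x /=; rewrite bijK. Qed.
Lemma bij_mulrV : right_inverse bij_one bij_opp bij_mul.
Proof. by move=> f; apply: bijectionP => x /=; rewrite bijVK. Qed.

HB.instance Definition _ := isGroup.Build bijection
  bij_mulA bij_mul1 bij_mulr1 bij_mulV bij_mulrV.
End SelfBijections.

(* Pilings (after Crisp, Godelle and Wiest): the stack of the vertex i records
   the syllables of G i, while every syllable of a vertex that is neither i nor
   adjacent to i leaves a marker [None] on it.  Commuting syllables touch
   disjoint data, so that words differing by shuffles have the same piling. *)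
Section Pilings.
Variables (V : choiceType) (adj : rel V) (G : V -> groupType).
Hypothesis adjC : symmetric adj.
Local Notation Gam := (graph_product adj G).

Definition piling := V -> seq (option (letter G)).

Implicit Types (i j : V) (p q : piling).

Definition push i (g : G i) p : piling := fun j =>
  if j == i then Some (lett g) :: p j
  else if adj i j then p j else None :: p j.

Definition top_free i p : bool := if p i is Some _ :: _ then false else true.

Definition top i p : G i :=
  if p i is Some l :: _ then tagged_as (lett (1 : G i)) l else 1.

Definition pop i p : piling :=
  if top_free i p then p else fun j =>
    if j == i then behead (p j) else if adj i j then p j else behead (p j).

Definition put i (g : G i) p : piling := if g == 1 then p else push g p.

Inductive legal : piling -> Prop :=
| legal_nil : legal (fun=> [::])
| legal_push i (g : G i) p :
    legal p -> g <> 1 -> top_free i p -> legal (push g p).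

Lemma legal_put i (g : G i) p : legal p -> top_free i p -> legal (put g p).
Proof. by rewrite /put; case: eqP => // g1 lp fp; apply: legal_push. Qed.

Lemma top_put i (g : G i) p : top_free i p -> top i (put g p) = g.
Proof.
rewrite /put /top /top_free; case: eqP => [-> |_ _].
  by case: (p i) => [|[l|] s].
by rewrite /push eqxx tagged_asE.
Qed.

Lemma pop_put i (g : G i) p : top_free i p -> pop i (put g p) = p.
Proof.
rewrite /put; case: eqP => [_ fp|_ _]; first by rewrite /pop fp.
rewrite /pop /top_free /push eqxx /=; apply/funext => j.
by case: eqP => // _; case: (adj i j).
Qed.

Lemma put_adj i j (g : G i) p : adj i j -> j <> i -> put g p j = p j.
Proof.
by rewrite /put /push => ij /(introF eqP) ji; case: eqP; rewrite // ji ij.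
Qed.

Lemma put_nadj i j (g : G i) p : g <> 1 -> ~~ adj i j -> j <> i ->
  put g p j = None :: p j.
Proof.
rewrite /put /push => /(introF eqP) -> /negPf -> /(introF eqP) ji.
by rewrite ji.
Qed.

Lemma putC i j (g : G i) (h : G j) p : adj i j -> j <> i ->
  put g (put h p) = put h (put g p).
Proof.
rewrite /put => ij ji; case: eqP => // _; case: eqP => // _.
apply/funext => k; rewrite /push.
have [->|ki] := eqVneq k i; last first.
  by case: eqP => [->|_]; [rewrite ij | case: (adj i k); case: (adj j k)].
by rewrite adjC ij; case: eqP => // /esym.
Qed.

(** Induction on the last syllable pushed, at [j]. For [j = i] it is the wanted [g]; for [j] not
    adjacent to [i] its marker covers the stack of [i], so [g = 1]; for [j] adjacent to [i] it
    commutes with the syllable given by induction. *)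
Lemma legal_split i p : legal p ->
  exists g : G i, exists q, [/\ legal q, top_free i q & p = put g q].
Proof.
elim=> [|j h q lq [g [q' [lq' fq' eq]]] h1 fq].
  by exists 1, (fun=> [::]); split; [constructor| |rewrite /put eqxx].
have push1 r : push h r = put h r by rewrite /put; move/(introF eqP): h1 => ->.
have [ij|/eqP ij] := eqVneq i j.
  by subst j; exists h, q; rewrite push1.
case aji: (adj j i); last first.
  exists 1, (push h q); split; first exact: legal_push.
    by rewrite push1 /top_free put_nadj // aji.
  by rewrite /put eqxx.
have aij : adj i j by rewrite adjC.
have ji : j <> i by move/esym.
exists g, (put h q'); split; last by rewrite push1 eq putC.
  apply: legal_put => //; move: fq; rewrite /top_free eq.
  by rewrite put_adj.
by rewrite /top_free put_adj.
Qed.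

(** Left multiplication by [g] replaces the exposed syllable of [G i], read as 1 if there is none,
    by its product with [g], and [put] leaves no trace of a trivial product. *)
Definition pact i (g : G i) p : piling := put (g * top i p) (pop i p).

Lemma pact_put i (g h : G i) p :
  top_free i p -> pact g (put h p) = put (g * h) p.
Proof. by move=> fp; rewrite /pact top_put // pop_put. Qed.

Lemma legal_pact i (g : G i) p : legal p -> legal (pact g p).
Proof.
move=> /(legal_split i) [h [q [lq fq ->]]].
by rewrite pact_put //; apply: legal_put.
Qed.

Lemma pactM i (g h : G i) p : legal p -> pact (g * h) p = pact g (pact h p).
Proof.
by move=> /(legal_split i) [k [q [lq fq ->]]]; rewrite !pact_put // mulgA.
Qed.

Lemma pact1 i p : legal p -> pact (1 : G i) p = p.
Proof.
by move=> /(legal_split i) [k [q [lq fq ->]]]; rewrite pact_put // mul1g.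
Qed.

Lemma pactC i j (g : G i) (h : G j) p : legal p -> adj i j -> j <> i ->
  pact g (pact h p) = pact h (pact g p).
Proof.
move=> lp ij ji; have ij' : i <> j by move/esym.
have ji' : adj j i by rewrite adjC.
have [k [q [lq fq ->]]] := legal_split i lp.
have [l [r [lr fr eq]]] := legal_split j lq.
have fri : top_free i r by move: fq; rewrite eq /top_free put_adj.
have frj (a : G i) : top_free j (put a r) by rewrite /top_free put_adj.
have fri' (a : G j) : top_free i (put a r) by rewrite /top_free put_adj.
rewrite eq (pact_put g) -?eq // eq.
rewrite [put k _]putC // (pact_put h) // [put (g * k) _]putC // pact_put //.
by rewrite -[put (h * l) _]putC // pact_put // putC.
Qed.

Lemma top_pact i (g : G i) p : legal p -> top i (pact g p) = g * top i p.
Proof.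
move=> /(legal_split i) [h [q [lq fq ->]]].
by rewrite pact_put // !top_put.
Qed.

Lemma top_pact_adj i j (g : G j) p : legal p -> adj i j -> i <> j ->
  top i (pact g p) = top i p.
Proof.
move=> /(legal_split j) [h [q [lq fq ->]]] ij nij.
by rewrite pact_put // /top !put_adj // adjC.
Qed.

(** A nontrivial syllable exposed at [i] has left a marker on the stack of every nonadjacent [j],
    which hides the syllables of [G j]. *)
Lemma top_excl i j p : legal p -> top i p <> 1 -> top j p <> 1 -> i <> j ->
  adj i j.
Proof.
move=> /(legal_split i) [h [q [lq fq ->]]]; rewrite top_put // => h1 tj ij.
apply/negPn/negP => nij; apply: tj; rewrite /top put_nadj //.
by move/esym.
Qed.

Definition legal_piling := {p : piling | legal p}.

Lemma legal_pilingP (p q : legal_piling) : sval p = sval q -> p = q.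
Proof.
case: p q => p lp [q lq] /= e; subst q.
by rewrite (Prop_irrelevance lp lq).
Qed.

Definition lact i (g : G i) (p : legal_piling) : legal_piling :=
  exist _ (pact g (sval p)) (legal_pact g (svalP p)).

Lemma lactK i (g : G i) : cancel (lact g) (lact g^-1).
Proof.
move=> [p lp]; apply: legal_pilingP => /=.
by rewrite -pactM // mulVg pact1.
Qed.

Lemma lactVK i (g : G i) : cancel (lact g^-1) (lact g).
Proof.
move=> [p lp]; apply: legal_pilingP => /=.
by rewrite -pactM // mulgV pact1.
Qed.

Definition piling_bij i (g : G i) : bijection legal_piling :=
  Bijection (lactK g) (lactVK g).

Lemma piling_bijM i : {morph @piling_bij i : g h / g * h}.
Proof.
move=> g h; apply: bijectionP => -[p lp]; apply: legal_pilingP => /=.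
exact: pactM.
Qed.

Hypothesis adj_irr : irreflexive adj.

Lemma piling_bijC i j (g : G i) (h : G j) :
  adj i j -> commute (piling_bij g) (piling_bij h).
Proof.
move=> ij; apply: bijectionP => -[p lp]; apply: legal_pilingP => /=.
by apply: pactC => // ji; rewrite ji adj_irr in ij.
Qed.

Definition gp_act : Gam -> bijection legal_piling := gp_lift piling_bij.

Definition gp_front i (x : Gam) : G i :=
  top i (sval (gp_act x (exist legal _ legal_nil))).
Arguments gp_front : clear implicits.

Lemma gp_front1 i : gp_front i 1 = 1.
Proof. by rewrite /gp_front /gp_act (morph_mulg1 (gp_liftM piling_bijM piling_bijC)). Qed.

Lemma gp_act_inj i (g : G i) x (p : legal_piling) :
  gp_act (gp_inj adj g * x) p = lact g (gp_act x p).
Proof.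
rewrite /gp_act (gp_liftM piling_bijM piling_bijC).
by rewrite (gp_liftE piling_bijM piling_bijC).
Qed.

Lemma gp_front_inj i (g : G i) x :
  gp_front i (gp_inj adj g * x) = g * gp_front i x.
Proof. by rewrite /gp_front gp_act_inj /= top_pact //; exact: svalP. Qed.

Lemma gp_front_adj i j (g : G j) x : adj i j ->
  gp_front i (gp_inj adj g * x) = gp_front i x.
Proof.
move=> ij; rewrite /gp_front gp_act_inj /= top_pact_adj //; first exact: svalP.
by move=> e; rewrite e adj_irr in ij.
Qed.

Lemma gp_front_excl i j x : gp_front i x <> 1 -> gp_front j x <> 1 -> i <> j ->
  adj i j.
Proof. by apply: top_excl; exact: svalP. Qed.
End Pilings.

(** * Retractions onto the subgroups generated by sets of vertex groups *)

Section Retractions.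
Variables (V : choiceType) (adj : rel V) (G : V -> groupType) (S : pred V).
Local Notation Gam := (graph_product adj G).

Definition gp_kill i (g : G i) : Gam := if S i then gp_inj adj g else 1.

Lemma gp_killM i : {morph @gp_kill i : g h / g * h}.
Proof.
by move=> g h; rewrite /gp_kill; case: (S i); rewrite ?mulg1 ?gp_injM.
Qed.

Lemma gp_killC i j (g : G i) (h : G j) :
  adj i j -> commute (gp_kill g) (gp_kill h).
Proof.
move=> ij; rewrite /gp_kill; case: (S i); case: (S j).
- exact: gp_inj_commute.
- exact: commute1.
- exact/commute_sym/commute1.
- exact: commute1.
Qed.

Definition gp_proj : Gam -> Gam := gp_lift gp_kill.

Lemma gp_projM : {morph gp_proj : x y / x * y}.
Proof. exact: gp_liftM gp_killM gp_killC. Qed.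

Lemma gp_projE i (g : G i) :
  gp_proj (gp_inj adj g) = if S i then gp_inj adj g else 1.
Proof. exact: gp_liftE gp_killM gp_killC _ _. Qed.
End Retractions.

(* The value [front i x] is the syllable of G i with which a reduced word for x
   can begin, or 1 if there is none. *)
Record syllabic (V : choiceType) (adj : rel V) (G : V -> groupType) := Syllabic {
  sgroup :> groupType;
  inj : forall i, G i -> sgroup;
  injM : forall i, {morph @inj i : g h / g * h};
  injC : forall i j (g : G i) (h : G j), adj i j -> commute (inj g) (inj h);
  inj_ind : forall P : sgroup -> Prop,
    P 1 -> (forall i (g : G i) x, P x -> P (inj g * x)) -> forall x, P x;
  proj : pred V -> sgroup -> sgroup;
  projM : forall S, {morph proj S : x y / x * y};
  proj_inj : forall S i (g : G i),
    proj S (inj g) = if S i then inj g else 1;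
  front : forall i, sgroup -> G i;
  front1 : forall i, front i 1 = 1;
  front_inj : forall i (g : G i) x, front i (inj g * x) = g * front i x;
  front_adj : forall i j (g : G j) x,
    adj i j -> front i (inj g * x) = front i x;
  front_excl : forall i j x,
    front i x <> 1 -> front j x <> 1 -> i <> j -> adj i j;
  syl_adjC : symmetric adj;
  syl_irr : irreflexive adj }.

Arguments inj {V adj G} s {i} g : rename.
Arguments proj {V adj G} s S x : rename.
Arguments front {V adj G} s i x : rename.

Definition gp_syllabic (V : choiceType) (adj : rel V) (G : V -> groupType)
    (adjC : symmetric adj) (adj_irr : irreflexive adj) : syllabic adj G :=
  Syllabic (@gp_injM V adj G) (@gp_inj_commute V adj G) (@gp_inj_ind V adj G)
    (@gp_projM V adj G) (@gp_projE V adj G)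
    (@gp_front1 V adj G adjC adj_irr) (@gp_front_inj V adj G adjC adj_irr)
    (@gp_front_adj V adj G adjC adj_irr) (@gp_front_excl V adj G adjC) adjC adj_irr.

(** * Words, parabolic subgroups and walls *)

Section Walls.
Variables (V : choiceType) (adj : rel V) (G : V -> groupType).
Variable D : syllabic adj G.
Local Notation word := (seq (letter G)).
Local Notation inj := (inj D).
Local Notation front := (front D).
Local Notation proj := (proj D).

Implicit Types (i j k : V) (x y z c : D) (w : word) (S T : pred V).

Let adjC : symmetric adj := syl_adjC D.
Let adj_irr : irreflexive adj := syl_irr D.

Lemma inj_one i : inj (1 : G i) = 1. Proof. exact: morph_mulg1 (@injM _ _ _ D i). Qed.
Lemma injV i (g : G i) : inj g^-1 = (inj g)^-1.
Proof. exact: morph_mulgV (@injM _ _ _ D i) g. Qed.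
Lemma proj_one S : proj S 1 = 1. Proof. exact: morph_mulg1 (@projM _ _ _ D S). Qed.
Lemma projV S x : proj S x^-1 = (proj S x)^-1.
Proof. exact: morph_mulgV (@projM _ _ _ D S) x. Qed.

Definition wval w : D := foldr (fun l x => inj (tagged l) * x) 1 w.
Definition tags w : seq V := [seq tag l | l <- w].

Lemma wval_cat u w : wval (u ++ w) = wval u * wval w.
Proof. by elim: u => [|l u IH] /=; rewrite ?mul1g // IH mulgA. Qed.

Lemma wvalP x : exists w, x = wval w.
Proof.
elim/(@inj_ind _ _ _ D): x => [|i g x [w ->]]; first by exists [::].
by exists (lett g :: w).
Qed.

Definition restrict S w : word := [seq l <- w | S (tag l)].

Lemma wval_restrict S w : wval (restrict S w) = proj S (wval w).
Proof.
elim: w => [|[i g] w IH] /=; first by rewrite proj_one.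
by rewrite projM proj_inj -IH; case: (S i) => //=; rewrite mul1g.
Qed.

Lemma proj_proj S T x : proj S (proj T x) = proj (predI S T) x.
Proof.
elim/(@inj_ind _ _ _ D): x => [|i g x IH]; first by rewrite !proj_one.
rewrite !projM !proj_inj IH /=; case: (T i); rewrite ?andbT ?andbF ?proj_one //.
by rewrite proj_inj.
Qed.

Lemma eq_proj S T x : S =1 T -> proj S x = proj T x.
Proof.
move=> eST; elim/(@inj_ind _ _ _ D): x => [|i g x IH]; first by rewrite !proj_one.
by rewrite !projM !proj_inj IH eST.
Qed.

(* The retraction onto the subgroup generated by the G i with S i has this
   subgroup as its set of fixed points. *)
Definition par S x : Prop := proj S x = x.

Lemma par1 S : par S 1. Proof. exact: proj_one. Qed.
Lemma parM S x y : par S x -> par S y -> par S (x * y).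
Proof. by rewrite /par projM => -> ->. Qed.
Lemma parV S x : par S x -> par S x^-1.
Proof. by rewrite /par projV => ->. Qed.
Lemma par_inj S i (g : G i) : S i -> par S (inj g).
Proof. by rewrite /par proj_inj => ->. Qed.
Lemma parMl S x y : par S x -> par S (x * y) -> par S y.
Proof. by move=> px pxy; rewrite -[y](mulKg x); apply: parM => //; exact: parV. Qed.
Lemma parJ S x z : par S x -> par S z -> par S (x ^ z).
Proof. by move=> px pz; rewrite /conjg; do !apply: parM => //; exact: parV. Qed.

Lemma par_proj S T x : par T x -> par (predI S T) (proj S x).
Proof.
move=> <-; rewrite /par !proj_proj; apply: eq_proj => i /=.
by case: (S i); case: (T i).
Qed.

Lemma par_inter S T x : par S x -> par T x -> par (predI S T) x.
Proof. by rewrite /par -proj_proj => pS ->. Qed.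

Lemma par_sub S T x : (forall i, S i -> T i) -> par S x -> par T x.
Proof.
move=> ST <-; rewrite /par proj_proj; apply: eq_proj => i /=.
by case Si: (S i); rewrite ?andbF // ST.
Qed.

Lemma par_word S w : all S (tags w) -> par S (wval w).
Proof.
elim: w => [_|[i g] w IH] /=; first exact: par1.
by case/andP=> Si /IH; apply: parM; exact: par_inj.
Qed.

Lemma parP S x : par S x -> exists2 w, x = wval w & all S (tags w).
Proof.
have [w ->] := wvalP x => <-; exists (restrict S w); rewrite ?wval_restrict //.
rewrite /tags /restrict all_map; apply/allP => l.
by rewrite mem_filter => /andP[].
Qed.

Lemma par_ind S (P : D -> Prop) : P 1 ->
  (forall i (g : G i) x, S i -> par S x -> P x -> P (inj g * x)) ->
  forall x, par S x -> P x.
Proof.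
move=> P1 PM x /parP[w ->]; elim: w => [|[i g] w IH] //= /andP[Si Sw].
by apply: PM => //; [exact: par_word | exact: IH].
Qed.

Lemma par1P i x : par (pred1 i) x -> exists g : G i, x = inj g.
Proof.
move: x; apply: par_ind => [|j g x /eqP ? _ [h ->]].
  by exists 1; rewrite inj_one.
by subst j; exists (g * h); rewrite injM.
Qed.

Lemma front_inj1 i (g : G i) : front i (inj g) = g.
Proof. by rewrite -[inj g]mulg1 front_inj front1 mulg1. Qed.

Lemma inj_eq1 i (g : G i) : inj g = 1 -> g = 1.
Proof. by move=> e; rewrite -(front_inj1 g) e front1. Qed.

Definition star i : pred V := fun j => (j == i) || adj i j.

Lemma star_refl i : star i i. Proof. by rewrite /star eqxx. Qed.
Lemma starC i j : star i j = star j i.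
Proof. by rewrite /star eq_sym adjC. Qed.
Lemma adj_star i j : adj i j -> star i j.
Proof. by rewrite /star => ->; rewrite orbT. Qed.

Lemma link_commute i u (g : G i) : par (adj i) u -> commute (inj g) u.
Proof.
move: u; apply: par_ind => [|j h x ij _ cx]; first exact: commute1.
by apply: commuteM => //; exact: injC.
Qed.

Lemma starP i x : par (star i) x ->
  exists g : G i, exists2 u, par (adj i) u & x = inj g * u.
Proof.
move: x; apply: par_ind => [|j g x /predU1P[?|ij] _ [h [u pu ->]]].
- by exists 1, 1; [exact: par1 | rewrite inj_one mul1g].
- by subst j; exists (g * h), u; rewrite ?injM ?mulgA.
- exists h, (inj g * u); first by apply: parM => //; exact: par_inj.
  by rewrite !mulgA (injC D h g ij).
Qed.

Lemma front_link i u x : par (adj i) u -> front i (u * x) = front i x.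
Proof.
move: u; apply: par_ind => [|j g u ij _ <-]; first by rewrite mul1g.
by rewrite -mulgA front_adj.
Qed.

Lemma front_linkE i u : par (adj i) u -> front i u = 1.
Proof. by move=> pu; rewrite -[u]mulg1 front_link // front1. Qed.

(** * Reduced words, and how [front] changes under right multiplication *)

Fixpoint reduced w : Prop := if w is l :: w' then
  [/\ tagged l <> 1, front (tag l) (wval w') = 1 & reduced w'] else True.

(** Each letter standing before the [i]-syllable is a nontrivial front of its suffix, so
    [front_excl] makes its vertex adjacent to [i], and the syllable commutes past it. *)
Lemma reduced_pull i w : reduced w -> front i (wval w) <> 1 ->
  exists w', [/\ reduced w', wval w = inj (front i (wval w)) * wval w',
    front i (wval w') = 1, i \in tags w & {subset tags w' <= tags w}].
Proof.
elim: w => [|[j g] w IH] /=; first by rewrite front1.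
case=> g1 fw rw fi; have [ij|ij] := eqVneq i j.
  subst j; exists w; rewrite front_inj fw mulg1 mem_head; split=> // k kw.
  by rewrite inE kw orbT.
have aij : adj i j.
  apply: (front_excl fi _ (elimN eqP ij)).
  by rewrite front_inj fw mulg1.
rewrite front_adj // in fi *; have [w' [rw' ew fw' iw sw]] := IH rw fi.
exists (existT _ j g :: w'); split=> /=.
- split=> //; rewrite -fw {1}ew front_adj //; last by rewrite adjC.
- by rewrite {1}ew !mulgA (injC D _ _ aij).
- by rewrite front_adj.
- by rewrite inE iw orbT.
- move=> k; rewrite !inE => /predU1P[->|/sw ->]; rewrite ?eqxx ?orbT //.
Qed.

Lemma reduced_word w :
  exists w', [/\ reduced w', wval w = wval w' & {subset tags w' <= tags w}].
Proof.
elim: w => [|[i g] w [w' [rw' ew sw]]] /=; first by exists [::].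
have sub v : {subset tags v <= tags w'} -> {subset tags v <= i :: tags w}.
  by move=> sv k /sv/sw kw; rewrite inE kw orbT.
have key v h : reduced v -> front i (wval v) = 1 ->
    {subset tags v <= tags w'} -> exists w'', [/\ reduced w'',
    inj (h : G i) * wval v = wval w'' & {subset tags w'' <= i :: tags w}].
  move=> rv fv sv; have [h1|/eqP h1] := eqVneq h 1.
    by exists v; rewrite h1 inj_one mul1g; split=> //; exact: sub.
  exists (existT _ i h :: v); split=> //= k; rewrite inE => /predU1P[->|].
    exact: mem_head.
  exact: sub.
rewrite ew; have [fi|/eqP fi] := eqVneq (front i (wval w')) 1; first exact: key.
have [v [rv ev fv _ sv]] := reduced_pull rw' fi.
by rewrite ev mulgA -injM; exact: key.
Qed.

Lemma front_supp S i x : par S x -> ~~ S i -> front i x = 1.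
Proof.
move=> /parP[w -> Sw] Si; apply/eqP/negPn/negP => /eqP fi.
have [w' [rw' ew sw]] := reduced_word w; rewrite ew in fi.
have [_ [_ _ _ /sw iw _]] := reduced_pull rw' fi.
by move/allP/(_ i iw): Sw; exact/negP.
Qed.

(** Induction on a reduced word for [x]. A first letter in the star of [i] reduces the claim to the
    tail. A first letter at another [k] forces [front i] to be 1, unless [s] cancels it; but then
    [x * inj s] lies in the link subgroup of [k], where [front i] is 1 as well. *)
Lemma front_step i j (s : G j) x :
  front i (x * inj s) <> front i x -> j = i /\ par (star i) x.
Proof.
have [w ->] := wvalP x; have [{x}{}w [rw -> _]] := reduced_word w.
elim: w i rw => [|[k t] w IH] i /=.
  move=> _; rewrite mul1g front1 => f1; split; last exact: par1.
  apply/eqP/negPn/negP => ji; apply: f1.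
  apply: (@front_supp (pred1 j)); first by apply: par_inj; rewrite /= eqxx.
  by rewrite /= eq_sym.
case=> t1 fw rw; rewrite -mulgA.
have [?|ik] := eqVneq i k.
  subst k; rewrite !front_inj => fi.
  have /IH[//|-> pw] : front i (wval w * inj s) <> front i (wval w).
    by move=> e; apply: fi; rewrite e.
  by split=> //; apply: parM => //; apply: par_inj; exact: star_refl.
case aik: (adj i k).
  rewrite !front_adj // => /IH[//|-> pw]; split=> //; apply: parM => //.
  exact/par_inj/adj_star.
have fk : front k (inj t * wval w) <> 1 by rewrite front_inj fw mulg1.
have excl x : front k x <> 1 -> front i x = 1.
  move=> fkx; apply/eqP/negPn/negP => /eqP fix1.
  by rewrite (front_excl fix1 fkx (elimN eqP ik)) in aik.
rewrite (excl _ fk) => fi.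
have /eqP : front k (inj t * (wval w * inj s)) = 1.
  by apply/eqP/negPn/negP => /eqP/excl.
rewrite front_inj mulg_eq1 => /eqP ft.
have /IH[//|jk pw] : front k (wval w * inj s) <> front k (wval w).
  rewrite fw => e; apply: t1; by rewrite ft e invg1.
subst j; case: fi; have [h [u pu ew]] := starP pw.
move: fw; rewrite ew front_inj front_linkE // mulg1 => h1.
have wu : wval w = u by rewrite ew h1 inj_one mul1g.
rewrite -ew wu -(link_commute s pu) mulgA -injM.
move: ft; rewrite wu -(link_commute s pu) front_inj front_linkE // mulg1 => ->.
rewrite mulVg inj_one mul1g; apply: front_supp pu _.
by rewrite adjC aik.
Qed.

(** The wall is the coset of [c] modulo the star subgroup of [i]. Its sides are indexed by elements
    of [G i], so there may be more than two. *)
Definition sep c i x y : Prop := front i (c^-1 * x) <> front i (c^-1 * y).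

Lemma sepM a c i x y : sep (a * c) i (a * x) (a * y) <-> sep c i x y.
Proof. by rewrite /sep invgM -!mulgA !mulKg. Qed.

Lemma nsep c i x y : ~ sep c i x y -> front i (c^-1 * x) = front i (c^-1 * y).
Proof. by move=> ns; apply/eqP/negPn/negP => /eqP. Qed.

Lemma sepC c i x y : sep c i x y -> sep c i y x.
Proof. by move=> s e; apply: s. Qed.

Lemma sep_triangle y c i x z : sep c i x z -> sep c i x y \/ sep c i y z.
Proof.
rewrite /sep => s; have [e|/eqP] := eqVneq (front i (c^-1 * x)) (front i (c^-1 * y)).
  by right; rewrite -e.
by left.
Qed.

(** If the side changes along a path, it changes at some edge, and [front_step] locates this
    edge. *)
Lemma sep_path c i x w : sep c i x (x * wval w) ->
  exists w1 l w2, [/\ w = w1 ++ l :: w2, tag l = i &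
    par (star i) (c^-1 * (x * wval w1))].
Proof.
elim: w x => [|l w IH] x /=; first by rewrite mulg1.
move/(sep_triangle (x * inj (tagged l))) => [].
  rewrite /sep mulgA => /nesym/front_step[ti px].
  by exists [::], l, w; rewrite /= mulg1.
rewrite mulgA => /IH[w1 [l' [w2 [-> ti pw]]]].
by exists (l :: w1), l', w2; rewrite /= [x * (_ * _)]mulgA.
Qed.

Lemma tags_mid w1 (l : letter G) w2 : tag l \in tags (w1 ++ l :: w2).
Proof. by rewrite /tags map_cat mem_cat map_cons mem_head orbT. Qed.

(** Two edges with label [i] cross the same wall exactly when the element read between them lies in
    the star subgroup of [i]: no wall is crossed twice. *)
Definition norep w : Prop := forall w1 l w2 l' w3,
  w = w1 ++ l :: w2 ++ l' :: w3 -> tag l = tag l' ->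
  ~ par (star (tag l)) (wval w2).

Definition nontriv w : bool := all (fun l : letter G => tagged l != 1) w.

(** The edge of [l] changes sides of its wall; another crossing, in [w1] or in [w2], would be a
    repetition. *)
Lemma norep_sep w1 l w2 : norep (w1 ++ l :: w2) -> tagged l <> 1 ->
  sep (wval w1) (tag l) 1 (wval (w1 ++ l :: w2)).
Proof.
move=> nr l1; rewrite /sep => e.
have sepl : sep (wval w1) (tag l) (wval w1) (wval w1 * inj (tagged l)).
  by rewrite /sep mulVg mulKg front1 front_inj1 => /esym.
suff [] : ~ sep (wval w1) (tag l) 1 (wval w1) /\
          ~ sep (wval w1) (tag l) (wval w1 * inj (tagged l)) (wval (w1 ++ l :: w2)).
  by move=> /nsep e1 /nsep e2; apply: sepl; rewrite -e1 e -e2.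
split.
  rewrite -{2}[wval w1]mul1g => /sep_path[a [l' [b [ew tl]]]].
  have pl := par_inj (tagged l') (star_refl (tag l')).
  rewrite mul1g ew wval_cat /= invgM -mulgA mulVg mulg1 => /parV.
  rewrite invgK -tl => /(parMl pl) pb.
  by apply: (nr a l' b l w2) => //; rewrite ew -catA.
rewrite wval_cat /= mulgA => /sep_path[a [l' [b [ew tl]]]].
rewrite -!mulgA mulKg => p.
have pa := parMl (par_inj (tagged l) (star_refl (tag l))) p.
by apply: (nr w1 l a l' b); rewrite ?ew.
Qed.

(** Every letter of [w] has a wall separating 1 from [wval w]. A word with letters in [S] for the
    same element must cross it too, by a letter with the same tag. *)
Lemma norep_par S w : norep w -> nontriv w -> par S (wval w) -> all S (tags w).
Proof.
move=> nr nt /parP[v ev /allP Sv]; rewrite all_map; apply/allP => l lw /=.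
move: nr nt ev; case/splitPr: lw => w1 w2 nr nt ev.
have l1 : tagged l <> 1.
  by apply/eqP; move: nt; rewrite /nontriv all_cat /= => /and3P[].
have := norep_sep nr l1; rewrite ev -[wval v]mul1g.
move=> /sep_path[a [l' [b [e <- _]]]]; apply: Sv.
by rewrite e; exact: tags_mid.
Qed.

Lemma min_word (P : word -> Prop) : (exists w, P w) ->
  exists w, P w /\ forall w', P w' -> size w <= size w'.
Proof.
move=> [w0 Pw0]; pose Q n := `[< exists w, P w /\ size w = n >].
have exQ : exists n, Q n by exists (size w0); apply/asboolP; exists w0.
case: (ex_minnP exQ) => n /asboolP[w [Pw <-]] min_w; exists w; split=> // w' Pw'.
by apply: min_w; apply/asboolP; exists w'.
Qed.

Definition short w : Prop := forall w', wval w' = wval w -> size w <= size w'.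

Lemma short_nontriv w : short w -> nontriv w.
Proof.
move=> sw; apply/allP => l lw; case/splitPr: lw sw => w1 w2 sw.
apply/eqP => l1; have := sw (w1 ++ w2).
rewrite !wval_cat /= l1 inj_one mul1g => /(_ erefl).
by rewrite !size_cat /= addnS ltnn.
Qed.

(* If two syllables of G i enclose an element of the star of i, then they can be
   merged: the i-syllables in between all move to the front. *)
Lemma short_norep w : short w -> norep w.
Proof.
move=> sw w1 [i g] w2 [j g'] w3 ew /= ij pw2; subst j.
have [h [u pu e2]] := starP pw2; pose w2' := restrict (predC1 i) w2.
have ew2' : wval w2' = u.
  rewrite wval_restrict e2 projM proj_inj /= eqxx mul1g.
  apply: par_sub pu => k ik /=; apply: contraTneq ik => ->.
  by rewrite adj_irr.
have := sw (w1 ++ lett (g * h * g') :: w2' ++ w3).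
rewrite ew !wval_cat /= wval_cat /= wval_cat e2 ew2' !injM => E.
suff /E : wval w1 * (inj g * inj h * inj g' * (u * wval w3)) =
   wval w1 * (inj g * (inj h * u * (inj g' * wval w3))).
  have sz : size w2' <= size w2 by rewrite size_filter count_size.
  rewrite !size_cat /= !size_cat /= leqNgt => /negP[].
  by rewrite ltn_add2l !ltnS addnS ltnS leq_add2r.
congr (_ * _); rewrite -!mulgA; do 2!congr (_ * _).
by rewrite !mulgA (link_commute g' pu).
Qed.

(** As [b x = x b'], right multiplication by [b'] changes [front k x] by the factor [b], and
    [front_step] applies. *)
Lemma conj_inj_star j k (b : G k) (b' : G j) x :
  b <> 1 -> inj b ^ x = inj b' -> k = j /\ par (star k) x.
Proof.
move=> b1 e; have /front_step[jk px] : front k (x * inj b') <> front k x.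
  rewrite -e -conjgC front_inj => e'; apply: b1.
  by apply: (mulIg (front k x)); rewrite mul1g.
by split.
Qed.

(* The first syllable of a shortest element y of the double coset of x has a
   label k outside of the star of i, and crosses the wall of k through 1.  Along
   the path 1, c, cy, y, this wall can only separate c from cy, where it has to be
   the translate of itself by c: hence c fixes it. *)
Lemma star_inter i j x :
  (exists e f, [/\ par (star i) e, par (star j) f & x = e * f]) \/
  (exists e k, [/\ par (star i) e, ~~ star i k &
    forall c, par (star i) c -> par (star j) (c ^ x) -> par (star k) (c ^ e)]).
Proof.
pose P w := exists e f, [/\ par (star i) e, par (star j) f & x = e * wval w * f].
have [w [[e [f [pe pf ex]]] wmin]] : exists w, P w /\ forall w', P w' -> size w <= size w'.
  apply: min_word; have [w ew] := wvalP x; exists w, 1, 1.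
  by rewrite mul1g mulg1; split=> //; exact: par1.
have Pw e' f' w' : par (star i) e' -> par (star j) f' ->
    wval w = e' * wval w' * f' -> size w <= size w'.
  move=> pe' pf' ew; apply: wmin; exists (e * e'), (f' * f).
  by rewrite ex ew !mulgA; split=> //; exact: parM.
have sw : short w.
  move=> w' ew; apply: (Pw 1 1); rewrite ?mul1g ?mulg1 //; exact: par1.
case: w ex Pw sw {wmin} => [|[k g] w] ex Pw sw.
  by left; exists e, f; rewrite ex mulg1.
right; have ki : ~~ star i k.
  apply/negP => ik; suff : (size w).+1 <= size w by rewrite ltnn.
  apply: (Pw (inj g) 1); rewrite ?mulg1 //; last exact: par1.
  exact: par_inj.
exists e, k; split=> // c0 pc0; set c := c0 ^ e.
set y := wval (existT _ k g :: w) in ex Pw *.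
have pc : par (star i) c by exact: parJ.
rewrite ex conjgM (conjgM _ e) -/c => /parJ/(_ (parV pf)); rewrite conjgK => {pc0} pcy.
have proj_i z : par (star i) z -> proj (predC1 k) z = z.
  apply: par_sub => m im /=; apply: contraTneq im => ->; exact: ki.
have proj_k z : par (star k) z -> exists h : G k, 
    z = inj h * proj (predC1 k) z /\ commute (inj h) (proj (predC1 k) z).
  move=> /starP[h [u pu ->]]; exists h.
  have -> : proj (predC1 k) (inj h * u) = u.
    rewrite projM proj_inj /= eqxx mul1g.
    apply: par_sub pu => m km /=; apply: contraTneq km => ->.
    by rewrite adj_irr.
  by split=> //; exact: link_commute.
have g1 : g <> 1 by apply/eqP; case/andP: (short_nontriv sw).
have sz m : size (restrict (predC1 k) m) <= size m by rewrite size_filter count_size.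
have := @norep_sep [::] (existT _ k g) w (short_norep sw) g1.
rewrite /= -/y => /(sep_triangle c)[|/(sep_triangle (c * y))[]].
- have [v ev /allP iv] := parP pc; rewrite {1}ev -[wval v]mul1g.
  move=> /sep_path[a [l' [b [ew tl _]]]]; case/negP: ki; rewrite -tl; apply: iv.
  by rewrite ew; exact: tags_mid.
(* A crossing between [c] and [c * y]. At the first letter it gives the conclusion; at a later one,
   [g] could be merged with the crossing letter, and the word would not be shortest. *)
- move=> /sep_path[[|l0 a] [[k' g'] [b [ew /= ?]]]]; subst k'.
    by rewrite /= mulg1 invg1 mul1g.
  case: ew => <- {l0} ew; rewrite invg1 mul1g /=.
  set z := inj g * wval a => pcz; exfalso.
  have [h [ez cu]] := proj_k _ pcz.
  have {}ez : z = wval (restrict (predC1 k) a) * inj h.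
    have -> : wval (restrict (predC1 k) a) = proj (predC1 k) z.
      by rewrite wval_restrict /z /= projM proj_inj /= eqxx mul1g.
    move: ez cu; rewrite projM proj_i // => ez cu.
    by apply: (mulgI c); rewrite ez cu mulgA.
  have := sw (restrict (predC1 k) a ++ lett (h * g') :: b).
  rewrite wval_cat /= injM ew /= !size_cat /=.
  have -> : wval (restrict (predC1 k) a) * (inj h * inj g' * wval b) =
    inj g * wval (a ++ existT _ k g' :: b).
    by rewrite wval_cat /= !mulgA -ez.
  by move=> /(_ erefl); rewrite ltnNge leq_add2r sz.
(* A crossing between [c * y] and [y]. Then [k] is in the star of [j], and [g] can be moved to the
   right into the star subgroup of [j], against minimality in the double coset. *)
- have -> : c * y = y * c ^ y by rewrite -conjgC.
  move=> /sepC; have [v ev /allP jv] := parP pcy; rewrite {1}ev.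
  move=> /sep_path[a [[k' g'] [b [evw /= ?]]]]; subst k'; rewrite invg1 mul1g.
  move=> pya; exfalso.
  have kj : star j k by apply: jv; rewrite evw; exact: (@tags_mid a (existT _ k g') b).
  have pa : par (star j) (wval a).
    apply: par_word; apply/allP => m ma; apply: jv.
    by rewrite evw /tags map_cat mem_cat ma.
  have [h [ey cu]] := proj_k _ pya.
  have := Pw 1 ((proj (predC1 k) (wval a)) * inj h * (wval a)^-1) (restrict (predC1 k) w).
  rewrite ltnNge sz => E; suff : ~~ true by []; apply: E; first exact: par1.
    apply: parM; last exact: parV.
    apply: parM; last exact: par_inj.
    by apply: par_sub (par_proj (predC1 k) pa) => m /= /andP[].
  rewrite mul1g; apply: (mulIg (wval a)); rewrite !mulgA mulgVK.
  have -> : wval (restrict (predC1 k) w) = proj (predC1 k) y.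
    by rewrite wval_restrict /y /= projM proj_inj /= eqxx mul1g.
  by rewrite -[X in _ = X * _]projM -cu.
Qed.

(** This excludes induced squares, and puts the intersection of the two star subgroups in a single
    vertex group. *)
Hypothesis no_square : forall i k, ~~ star i k ->
  exists l, forall j, star i j -> star k j -> j = l.

(** If [B] is conjugate into a vertex group, [conj_inj_star] bounds its centralizer. Otherwise, let
    [x] commute with [B]. In the second case of [star_inter] for [x ^ z], the hypothesis [no_square]
    would conjugate [B] into a vertex group; in the first, [x ^ z] is in the star subgroup of
    [i]. *)
Lemma star_centralizer (B : D -> Prop) z i :
  (forall b, B b -> par (star i) (b ^ z)) -> (exists2 b, B b & b <> 1) ->
  exists z' k, forall x,
    B x \/ (forall b, B b -> commute b x) -> par (star k) (x ^ z').
Proof.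
move=> Bz [b Bb b1].
have [[e [l Be]]|nB] := pselect (exists e l, forall c, B c -> exists g : G l, c ^ e = inj g).
  exists e, l => x [Bx|Cx].
    by have [g ->] := Be _ Bx; exact/par_inj/star_refl.
  have [g eg] := Be _ Bb; have g1 : g <> 1.
    move=> g1; move: eg; rewrite g1 inj_one => /eqP; rewrite conjg_eq1.
    by move/eqP.
  apply: (proj2 (conj_inj_star (b' := g) g1 _)).
  by rewrite -eg -conjgM -conjgC conjgM; congr (_ ^ _); rewrite conjgE (Cx b Bb) mulKg.
exists z, i => x [/Bz //|Cx].
have [[e [f [pe pf ->]]]|[e [k [pe ki H]]]] := star_inter i i (x ^ z).
  exact: parM.
have [l lP] := no_square ki; case: nB; exists (z * e), l => c Bc.
have pc : par (predI (star i) (star k)) (c ^ (z * e)).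
  apply: par_inter; first by rewrite conjgM; apply: parJ => //; exact: Bz.
  rewrite conjgM; apply: H; first exact: Bz.
  rewrite -conjJg; have -> : c ^ x = c by rewrite conjgE (Cx c Bc) mulKg.
  exact: Bz.
by apply: par1P; apply: par_sub pc => j /andP[/lP H1 /H1 ->] /=; rewrite eqxx.
Qed.

Lemma pigeonhole (T : finType) (P : nat -> T -> Prop) :
  (forall n, exists t, P n t) -> exists m n t, [/\ m < n, P m t & P n t].
Proof.
move=> /boolp.choice[f fP]; pose g (i : 'I_#|T|.+1) := f i.
have /injectivePn[i [j ij egij]] : ~~ injectiveb g.
  by apply/injectiveP => /leq_card; rewrite card_ord ltnn.
wlog lt_ij : i j ij egij / i < j => [H|].
  have [/H|/H|/val_inj/eqP] := ltngtP i j; last by rewrite (negPf ij).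
    by apply.
  by apply=> //; rewrite eq_sym.
by exists i, j, (g i); split; rewrite // egij; exact: fP.
Qed.

(** * Axes of elements that lie in no conjugate of a star subgroup *)

Section Skewer.
Variables (l0 : letter G) (w : word).
Let a := wval w.
Let m := size w.
Hypothesis m_gt0 : 0 < m.
Hypothesis w_min : forall z w', wval w' = a ^ z -> m <= size w'.
Hypothesis a_star : forall z k, ~ par (star k) (a ^ z).

(** The periodic word [w w w ...] labels a ray of the axis of [a]; [l0] is the default value of
    [nth]. *)
Definition per_letter t := nth l0 w (t %% m).
Definition per t n : word := [seq per_letter s | s <- iota t n].

Lemma size_per t n : size (per t n) = n.
Proof. by rewrite size_map size_iota. Qed.

Lemma perD t n1 n2 : per t (n1 + n2) = per t n1 ++ per (t + n1) n2.
Proof. by rewrite /per iotaD map_cat. Qed.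

Lemma per_mod t n : per (t + m) n = per t n.
Proof.
rewrite /per addnC iotaDl -map_comp; apply: eq_map => j /=.
by rewrite /per_letter modnDl.
Qed.

Lemma per0 : per 0 m = w.
Proof.
rewrite -[RHS](mkseq_nth l0); apply/eq_in_map => j.
by rewrite mem_iota /per_letter => /andP[_ jm]; rewrite modn_small.
Qed.

Lemma wval_per_period d : wval (per 0 (d * m)) = a ^+ d.
Proof.
elim: d => // d IH; rewrite mulSn perD wval_cat per0 expgS; congr (_ * _).
by rewrite add0n -[m in per m]add0n per_mod.
Qed.

Lemma wval_per t : wval (per t m) = a ^ wval (per 0 t).
Proof.
apply: (mulgI (wval (per 0 t))); rewrite -conjgC -wval_cat -{2}[t]add0n -perD.
by rewrite addnC perD wval_cat per0 add0n -[m in per m]add0n per_mod.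
Qed.

Lemma per_catE t n w1 w2 : per t n = w1 ++ w2 ->
  [/\ n = (size w1 + size w2)%N, w1 = per t (size w1) & w2 = per (t + size w1) (size w2)].
Proof.
move=> e; have en : n = (size w1 + size w2)%N by rewrite -size_cat -e size_per.
move: e; rewrite en perD => /eqP; rewrite eqseq_cat ?size_per //.
by case/andP=> /eqP <- /eqP <-; rewrite !size_per.
Qed.

Lemma perS t n : per t n.+1 = per_letter t :: per t.+1 n.
Proof. by []. Qed.

Lemma per_mid t n w1 l w2 : per t n = w1 ++ l :: w2 ->
  [/\ n = (size w1 + (size w2).+1)%N, w1 = per t (size w1),
    l = per_letter (t + size w1) & w2 = per (t + size w1).+1 (size w2)].
Proof. by move=> /per_catE[-> e1]; rewrite perS => -[-> <-]. Qed.

Lemma short_per t : short (per t m).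
Proof. by move=> w' ew'; rewrite size_per; apply: w_min; rewrite ew' wval_per. Qed.

Lemma per_not_star t n k : m <= n -> ~ all (star k) (tags (per t n)).
Proof.
move=> mn; rewrite -(subnKC mn) perD /tags map_cat all_cat => /andP[/par_word].
by rewrite wval_per => /a_star.
Qed.

Lemma nontriv_per t n : nontriv (per t n).
Proof.
have /allP nt := short_nontriv (@short_per 0); rewrite per0 in nt.
by apply/allP => _ /mapP[j _ ->]; apply/nt/mem_nth; rewrite ltn_mod.
Qed.

(** Induction on the gap between the two letters. If both fit in a window of length [m], this window
    is a shortest word. If not, the word between them crosses no wall twice by induction, so
    [norep_par] puts its letters in the star, and a conjugate of [a] would lie in a star
    subgroup. *)
Lemma norep_per t n : norep (per t n).
Proof.
suff key d : forall t, tag (per_letter t) = tag (per_letter (t + d.+1)) ->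
    ~ par (star (tag (per_letter t))) (wval (per t.+1 d)).
  move=> w1 l w2 l' w3 /per_mid[_ _ el /esym/per_mid[_ ew2 el' _]].
  by rewrite ew2 el el' addSnnS => tl; exact: key.
elim/ltn_ind: d => d IH {}t tl pd.
have [dm|dm] := ltnP d.+1 m.
  have := short_norep (@short_per t).
  rewrite -(subnKC dm) -[d.+2]addn1 -addnA -[d.+1]add1n -!addnA perD.
  rewrite perD [per _ (1 + _)]perD /= => /(_ [::] _ _ _ _ erefl); apply.
    by rewrite tl !addn1 addnS addSn.
  by rewrite addn1.
have nr : norep (per t.+1 d).
  move=> w1 l w2 l' w3 /per_mid[ed _ el /esym/per_mid[ed' ew2 el' _]].
  rewrite ew2 el el' addSnnS => tl'; apply: IH; last by rewrite tl' addSnnS.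
  by rewrite ed size_cat; apply: leq_trans (leq_addl _ _); rewrite ltnS leq_addr.
apply: (@per_not_star t d.+1 (tag (per_letter t)) dm).
rewrite /= star_refl /=; exact: norep_par nr (nontriv_per _ _) pd.
Qed.

Lemma power_not_star d k : 0 < d -> ~ par (star k) (a ^+ d).
Proof.
move=> d0; rewrite -wval_per_period => /(norep_par (@norep_per _ _) (nontriv_per _ _)).
by apply: per_not_star; rewrite leq_pmull.
Qed.

Let i0 := tag (per_letter 0).

(** The wall is that of the first letter of the second half of the path, which is again the first
    letter of [w]. *)
Lemma axis_sep d : 0 < d -> sep (a ^+ d) i0 1 (a ^+ (d + d)).
Proof.
move=> d0; rewrite -!wval_per_period mulnDl perD add0n.
have dm : 0 < d * m by rewrite muln_gt0 d0.
have E : per_letter (d * m) = per_letter 0 by rewrite /per_letter modnMl mod0n.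
have E' : per (d * m) (d * m) = per_letter 0 :: per (d * m).+1 (d * m).-1.
  by rewrite -{2}(prednK dm) perS E.
have := @norep_per 0 (d * m + d * m); rewrite perD add0n E' => nr.
apply: norep_sep nr _; apply/eqP.
by have := nontriv_per 0 1; rewrite /= andbT.
Qed.

Lemma commute_mid (b p : D) d e : commute a b ->
  b^-1 * (a ^+ d)^-1 * p * (b^-1 * (a ^+ (d + e))^-1 * p)^-1 = a ^+ e.
Proof.
move=> cab; rewrite !invgM !invgK expgnDr !mulgA mulgK.
rewrite -!mulgA mulKg; apply: (mulgI b); rewrite mulVKg.
exact/commute_sym/commuteX/commute_sym.
Qed.

Lemma wval_per0 t : wval (per 0 t) = a ^+ (t %/ m) * wval (take (t %% m) w).
Proof.
have per_mul q n : per (q * m) n = per 0 n.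
  by elim: q => // q <-; rewrite mulSn addnC per_mod.
rewrite {1}(divn_eq t m) perD wval_cat wval_per_period add0n per_mul.
congr (_ * wval _); have := ltnW (ltn_pmod t m_gt0); move: (t %% m) => r rm.
by rewrite -per0 -(subnKC rm) perD take_size_cat ?size_per.
Qed.

(* The wall b J, with J the wall of the first letter of w, separates the points
   b a^-n and b a^n at distance |b| from a^-n and a^n for all n > 0.  As a has no
   power in the stabilizer of b J, this wall must meet the axis of a. *)
Lemma axis_shift b : commute a b ->
  exists d t r, r < m /\
    par (star i0) (b^-1 * (a ^+ d)^-1 * (a ^+ t * wval (take r w))).
Proof.
move=> cab; apply: contrapT => H.
have [v ev] := wvalP b.
(* The path runs from [b] to 1, along the axis, then over a translate of [v]. If the wall is not
   crossed on the axis, it is crossed on one of the two copies of [v]: [s.1] tells on which, [s.2]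
   at which letter. *)
pose P d (s : bool * 'I_(size v).+1) := par (star i0)
  (b^-1 * (if s.1 then a ^+ d else (a ^+ d)^-1) * wval (take s.2 v)).
have /pigeonhole[d [d' [[s r] [dd' Pd Pd']]]] : forall d, exists s, P d.+1 s.
  move=> d; have := axis_sep (ltn0Sn d).
  rewrite -(sepM b); set n := d.+1.
  have cX e : b * a ^+ e = a ^+ e * b by apply/commuteX/commute_sym.
  have mid v1 l v2 s : v = v1 ++ l :: v2 ->
    par (star i0) (b^-1 * (if s then a ^+ n else (a ^+ n)^-1) * wval v1) ->
    exists s, P n s.
    move=> e pv; have r : size v1 < (size v).+1 by rewrite e size_cat /= ltnS leq_addr.
    exists (s, Ordinal r); rewrite /P /=.
    by have -> : take (size v1) v = v1 by rewrite e take_size_cat.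
  rewrite mulg1 !cX => /(sep_triangle 1)[|/(sep_triangle (a ^+ (n + n)))[]].
  - move/sepC; rewrite {2}ev -[X in sep _ _ _ X]mul1g.
    move=> /sep_path[v1 [l [v2 [e _]]]]; rewrite mul1g invgM.
    exact: mid false e.
  - rewrite -[X in sep _ _ _ X]mul1g -[X in sep _ _ _ (_ * X)]wval_per_period.
    move=> /sep_path[v1 [l [v2 [/per_mid[_ ev1 _ _] _]]]].
    rewrite mul1g ev1 wval_per0 invgM => pv.
    by case: H; exists n, (size v1 %/ m), (size v1 %% m); rewrite ltn_mod.
  - rewrite {2}ev => /sep_path[v1 [l [v2 [e _]]]]; rewrite invgM expgnDr.
    rewrite !mulgA mulgVK; exact: mid true e.
have [e ed'] : exists e, d'.+1 = (d.+1 + e.+1)%N.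
  by exists (d' - d.+1)%N; rewrite addnS subnKC.
(* Two exponents with the same crossing: the quotient of the two star elements is a positive power
   of [a]. *)
rewrite /P ed' {P ed' dd'} in Pd Pd'; apply: (@power_not_star e.+1 i0) => //.
case: s Pd Pd' => /= Pd Pd'.
  have := parM Pd' (parV Pd); rewrite !invgM !mulgA mulgK.
  rewrite addnC expgnDr !mulgA mulgK invgK -mulgA.
  by rewrite (commute_sym (commuteX _ (commute_sym cab))) mulKg.
by have := parM Pd (parV Pd'); rewrite commute_mid.
Qed.

(** By [axis_shift], two translates of a wall by powers of [b] meet the axis at the same position
    modulo [m]. So some power of [b] times a power of [a] lies in a star subgroup and commutes with
    [a]. It is trivial, since otherwise [star_centralizer] would conjugate [a] into a star
    subgroup. *)
Lemma skewer b : commute a b -> 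
  exists d p q, 0 < d /\ b ^+ d * a ^+ p = a ^+ q.
Proof.
move=> cab; pose P s (r : 'I_m) := exists d t,
  par (star i0) ((b ^+ s)^-1 * (a ^+ d)^-1 * (a ^+ t * wval (take r w))).
have /pigeonhole[s [s' [r [ss' [d [t Ps]] [d' [t' Ps']]]]]] : forall s, exists r, P s r.
  move=> s; have [d [t [r [rm pr]]]] := axis_shift (commuteX s cab).
  by exists (Ordinal rm), d, t.
set c := b ^+ (s' - s) * a ^+ (t + d').
exists (s' - s)%N, (t + d')%N, (d + t')%N; split; first by rewrite subn_gt0.
apply: (mulIg (a ^+ (d + t'))^-1); rewrite mulgV -/c; apply: contrapT => c1.
have cac : commute (c * (a ^+ (d + t'))^-1) a.
  apply/commute_sym/commuteM; last exact/commuteV/commuteX/commute_refl.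
  by apply: commuteM; [exact: commuteX | exact/commuteX/commute_refl].
have pc : par (star i0) (c * (a ^+ (d + t'))^-1).
  have := parM Ps (parV Ps'); rewrite !invgM !invgK !mulgA mulgK.
  have C n n' : commute (a ^+ n) (a ^+ n') by apply/commuteX2/commute_refl.
  have cM : commute (b ^+ s') (a ^+ (t + d') * (a ^+ (d + t'))^-1).
    have cb n : commute (b ^+ s') (a ^+ n) by exact/commuteX2/commute_sym.
    by apply: commuteM; [exact: cb | exact/commuteV/cb].
  suff -> : c * (a ^+ (d + t'))^-1 =
    (b ^+ s)^-1 * (a ^+ d)^-1 * a ^+ t * (a ^+ t')^-1 * a ^+ d' * b ^+ s' by []; rewrite /c.
  have -> : b ^+ (s' - s) = (b ^+ s)^-1 * b ^+ s'.
    by rewrite -{2}(subnKC (ltnW ss')) expgnDr mulKg.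
  rewrite -!mulgA; congr (_ * _); rewrite cM !mulgA; congr (_ * _).
  rewrite -[RHS]mulgA (commute_sym (commuteV (C d' t'))) !mulgA.
  rewrite -(mulgA _ (a ^+ t)) -expgnDr -(commuteV (C (t + d') d)).
  by rewrite -mulgA -invgM -expgnDr (addnC t').
have [||z [k /(_ a) zk]] := @star_centralizer (eq (c * (a ^+ (d + t'))^-1)) 1 i0.
- by move=> _ <-; rewrite conjg1.
- by exists (c * (a ^+ (d + t'))^-1).
by apply: (@a_star z k); apply: zk; right => _ <-.
Qed.
End Skewer.

Lemma star_conj_or_axial a : a <> 1 -> (exists z k, par (star k) (a ^ z)) \/
  [/\ forall d, 0 < d -> a ^+ d <> 1 &
    forall b, commute a b -> exists d p q, 0 < d /\ b ^+ d * a ^+ p = a ^+ q].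
Proof.
move=> a1; have [|a_star] := pselect (exists z k, par (star k) (a ^ z)).
  by left.
right; have [w [[z ew] wmin]] : exists w, (exists z, wval w = a ^ z) /\
    forall w', (exists z, wval w' = a ^ z) -> size w <= size w'.
  by apply: min_word; have [w ew] := wvalP a; exists w, 1; rewrite conjg1.
have astar z' k : ~ par (star k) (wval w ^ z').
  by rewrite ew -conjgM => pk; apply: a_star; exists (z * z'), k.
have m_gt0 : 0 < size w.
  case: w ew {wmin astar} => //= /esym/eqP; rewrite conjg_eq1 => /eqP.
  by move/a1.
have l0 : letter G by case: w m_gt0 {ew wmin astar} => // l.
have wm z' w' : wval w' = wval w ^ z' -> size w <= size w'.
  by rewrite ew -conjgM => e; apply: wmin; exists (z * z').
split=> [d d0 ad|b cab].
  apply: (@power_not_star l0 w m_gt0 wm astar d (tag l0) d0).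
  by rewrite ew -conjXg ad conj1g; exact: par1.
have [|d [p [q [d0 e]]]] := skewer l0 m_gt0 wm astar (b := b ^ z).
  by rewrite /commute ew -!conjMg cab.
exists d, p, q; split=> //; apply: (@conjg_inj _ z).
by rewrite conjMg !conjXg -ew.
Qed.

(** If neither [a] nor [b] were conjugate into a star subgroup, a positive power of [a] would be a
    power of [b], hence 1, against infinite order. Once [b] is conjugate into a star subgroup,
    [star_centralizer] passes from [b] to [A], then from [A] to [A] and [B] together. *)
Lemma star_of_product (A B : D -> Prop) :
  (forall x y, A x -> A y -> A (x * y)) ->
  (forall x y, B x -> B y -> B (x * y)) -> (forall x, B x -> B x^-1) ->
  (forall x y, A x -> B y -> commute x y) ->
  (forall x, A x -> B x -> x = 1) ->
  (exists2 x, A x & x <> 1) -> (exists2 x, B x & x <> 1) ->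
  exists z k, forall x, A x \/ B x -> par (star k) (x ^ z).
Proof.
move=> AM BM BV cAB AB1 [a Aa a1] [b Bb b1].
have powX (C : D -> Prop) : (forall x y, C x -> C y -> C (x * y)) ->
    forall x n, C x -> C (x ^+ n.+1).
  move=> CM x n Cx; elim: n => [|n IH]; first by rewrite expg1.
  by rewrite expgS; apply: CM.
have B1 : B 1 by rewrite -(mulgV b); apply: BM => //; exact: BV.
have BX n : B (b ^+ n) by case: n => // n; exact: powX.
have [z [k bk]] : exists z k, par (star k) (b ^ z).
  have [//|[_ bax]] := star_conj_or_axial b1.
  have [[z [k ak]]|[tf _]] := star_conj_or_axial a1.
    have [||z' [k' H]] := @star_centralizer (eq a) z k.
    - by move=> _ <-.
    - by exists a.
    by exists z', k'; apply: H; right => _ <-; exact: cAB.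
  have [|d [p [q [d0 e]]]] := bax a; first exact/commute_sym/cAB.
  case: (tf d d0); apply: AB1; first by case: d d0 {e} => // d _; exact: powX.
  by rewrite -[_ ^+ d](mulgK (b ^+ p)) e; apply: BM => //; exact: BV.
have [||z1 [k1 H1]] := @star_centralizer (eq b) z k.
- by move=> _ <-.
- by exists b.
have [||z2 [k2 H2]] := @star_centralizer A z1 k1.
- by move=> x Ax; apply: H1; right => _ <-; apply/commute_sym/cAB.
- by exists a.
exists z2, k2 => x [Ax|Bx]; apply: H2; [by left | right => c Ac].
exact: cAB.
Qed.

(** * Ping-pong in the free product of two nonadjacent vertex groups *)

Section PingPong.
Variables p q : V.
Hypothesis pq : p <> q.
Hypothesis npq : ~~ adj p q.

Lemma front_npq x : front p x <> 1 -> front q x = 1.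
Proof.
move=> fp; apply/eqP/negPn/negP => /eqP fq.
by case/negP: npq; exact: front_excl fp fq pq.
Qed.

Lemma front_nqp x : front q x <> 1 -> front p x = 1.
Proof.
by move=> fq; apply/eqP/negPn/negP => /eqP/front_npq.
Qed.

(** Beginning in [G q] and ending in [G p], a nontrivial such product absorbs neither letters of
    [G p] on its left nor letters of [G q] on its right. *)
Inductive alternating : D -> Prop :=
| alt_one : alternating 1
| alt_mul (s : G q) (t : G p) x : s <> 1 -> t <> 1 -> alternating x ->
    alternating (inj s * (inj t * x)).

Lemma alternating_split u : par (pred2 p q) u ->
  exists (a : G p) u0 (b : G q),
    alternating u0 /\ u = inj a * (u0 * inj b).
Proof.
move: u; apply: par_ind => [|i g x pqi _ [a [u0 [b [altu ->]]]]].
  by exists 1, 1, 1; rewrite !inj_one !mulg1; split; first exact: alt_one.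
case/orP: pqi => /eqP ?; subst i.
  by exists (g * a), u0, b; rewrite injM !mulgA.
have [->|/eqP g1] := eqVneq g 1.
  by exists a, u0, b; rewrite inj_one mul1g.
have [->|/eqP a1] := eqVneq a 1; last first.
  exists 1, (inj g * (inj a * u0)), b; rewrite inj_one mul1g !mulgA; split=> //.
  by rewrite -mulgA; exact: alt_mul.
rewrite inj_one mul1g; case: altu => [|s t y s1 t1 alty].
  by exists 1, 1, (g * b); rewrite inj_one !mul1g injM; split=> //; exact: alt_one.
have [gs1|/eqP gs1] := eqVneq (g * s) 1.
  exists t, y, b; split=> //.
  by rewrite !mulgA -injM gs1 inj_one mul1g.
exists 1, (inj (g * s) * (inj t * y)), b; split; first exact: alt_mul.
by rewrite inj_one mul1g injM !mulgA.
Qed.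

Lemma alternating_front u y :
  alternating u -> front q y <> 1 -> front q (u * y) <> 1.
Proof.
move=> altu; elim: altu y => [|s t x s1 t1 _ IH] y fy; first by rewrite mul1g.
have fp : front p (inj t * (x * y)) <> 1.
  by rewrite front_inj front_nqp ?mulg1 //; exact: IH.
by rewrite -!mulgA front_inj front_npq // mulg1.
Qed.

Lemma alternating_frontV u y :
  alternating u -> front p y <> 1 -> front p (u^-1 * y) <> 1.
Proof.
have V1 i (g : G i) : g <> 1 -> g^-1 <> 1.
  by move=> g1 /(congr1 inv); rewrite invgK invg1.
move=> altu; elim: altu y => [|s t x s1 t1 _ IH] y fy.
  by rewrite invg1 mul1g.
rewrite !invgM -!mulgA -!injV; apply: (IH).
have fq : front q (inj s^-1 * y) <> 1.
  by rewrite front_inj front_npq // mulg1; exact: V1.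
by rewrite front_inj front_nqp // mulg1; exact: V1.
Qed.

Section Generation.
Variable u : D.
Hypothesis altu : alternating u.
Hypothesis u1 : u <> 1.

(** The last letter of [u^-1] is in [G q] and may merge with [h]; the letter of [G p] before it
    survives. *)
Lemma alternating_frontV_inj (h : G q) : front p (u^-1 * inj h) <> 1.
Proof.
move: u1; case: altu => // s t x s1 t1 altx _.
rewrite !invgM -!mulgA -!injV; apply: alternating_frontV => //.
rewrite -injM front_inj (@front_supp (pred1 q)) ?mulg1.
- by move=> /(congr1 inv); rewrite invgK invg1.
- by apply: par_inj; rewrite /= eqxx.
- exact/eqP.
Qed.

(* Alternating products of elements of G p and of u G_q u^-1, where the flag
   tells that the first factor comes from G p. *)
Inductive syllables : bool -> D -> Prop :=
| syl_one r : syllables r 1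
| syl_p (a : G p) y : a <> 1 -> syllables false y -> syllables true (inj a * y)
| syl_q (b : G q) y : b <> 1 -> syllables true y ->
    syllables false (u * (inj b * (u^-1 * y))).

Lemma syllables_p (a : G p) x :
  (exists r, syllables r x) -> exists r, syllables r (inj a * x).
Proof.
have [->|/eqP a1] := eqVneq a 1; first by rewrite inj_one mul1g.
have key y : syllables false y -> exists r, syllables r (inj a * y).
  by exists true; exact: syl_p.
move=> [r sx]; case: sx => [_|a' y a'1 sy|b y b1 sy].
- by apply: key; exact: syl_one.
- rewrite mulgA -injM; have [->|/eqP aa1] := eqVneq (a * a') 1.
    by exists false; rewrite inj_one mul1g.
  by exists true; exact: syl_p.
- by apply: key; exact: syl_q.
Qed.

Lemma syllables_q (b : G q) x :
  (exists r, syllables r x) -> exists r, syllables r (u * (inj b * (u^-1 * x))).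
Proof.
have [->|/eqP b1] := eqVneq b 1; first by rewrite inj_one mul1g mulVKg.
have key y : syllables true y -> exists r, syllables r (u * (inj b * (u^-1 * y))).
  by exists false; exact: syl_q.
move=> [r sx]; case: sx => [_|a y a1 sy|b' y b'1 sy].
- by apply: key; exact: syl_one.
- by apply: key; exact: syl_p.
- rewrite mulKg (mulgA (inj b)) -injM; have [->|/eqP bb1] := eqVneq (b * b') 1.
    by exists true; rewrite inj_one mul1g mulVKg.
  by exists false; exact: syl_q.
Qed.

Lemma syllables_front r x : syllables r x -> x <> 1 ->
  if r then front p x <> 1 else front q (u^-1 * x) <> 1.
Proof.
elim=> {r x} [r //|a y a1 _ IH _|b y b1 _ IH _].
  rewrite front_inj; have [->|/eqP y1] := eqVneq y 1.
    by rewrite front1 mulg1.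
  rewrite front_nqp ?mulg1 // -[y](mulVKg u).
  by apply: alternating_front => //; exact: IH.
rewrite mulKg front_inj; suff -> : front q (u^-1 * y) = 1 by rewrite mulg1.
apply: front_npq; have [->|/eqP y1] := eqVneq y 1.
  by rewrite -(inj_one q); exact: alternating_frontV_inj.
by apply: alternating_frontV => //; exact: IH.
Qed.

Lemma syllables_inj r (h : G q) : syllables r (inj h) -> h = 1.
Proof.
move=> sh; apply: contrapT => h1.
have ih1 : inj h <> 1 by move/inj_eq1.
have := syllables_front sh ih1; case: r sh => sh.
  case; apply: (@front_supp (pred1 q)); last exact/eqP.
  by apply: par_inj; rewrite /= eqxx.
by case; apply: front_npq; exact: alternating_frontV_inj.
Qed.
End Generation.

(** Write [u = a u0 b] with [u0] alternating. Conjugation by [a] turns the hypothesis on [K], which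
    expresses generation, into one on [G p] and the conjugate of [G q] by [u0]. If [u0] is not 1,
    ping-pong keeps the nontrivial elements of [G q] out of the subgroup they generate. *)
Lemma generating_pair u : par (pred2 p q) u -> (exists h : G q, h <> 1) ->
  (forall K : D -> Prop, K 1 ->
    (forall (g : G p) x, K x -> K (inj g * x)) ->
    (forall (h : G q) x, K x -> K (u * (inj h * (u^-1 * x)))) ->
    forall x, par (pred2 p q) x -> K x) ->
  exists (a : G p) (b : G q), u = inj a * inj b.
Proof.
move=> /alternating_split[a [u0 [b [altu ->]]]] [h h1] gen.
have [->|/eqP u01] := eqVneq u0 1; first by exists a, b; rewrite mul1g.
case: h1; pose K x := exists r, syllables u0 r ((inj a)^-1 * (x * inj a)).
have [||||r] := gen K _ _ _ (inj a * (inj h * (inj a)^-1)).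
- by exists true; rewrite mul1g mulVg; exact: syl_one.
- move=> g x [r sx]; have := syllables_p (g ^ a) (ex_intro _ r sx).
  by rewrite /K /conjg !injM injV -!mulgA mulVKg.
- move=> g x [r sx]; have := syllables_q (u := u0) (b * g * b^-1) (ex_intro _ r sx).
  by rewrite /K !injM injV !invgM -!mulgA mulKg.
- by do !apply: parM; rewrite -?injV; apply: par_inj; rewrite /= eqxx ?orbT.
by rewrite -!mulgA mulVg mulg1 mulKg => /(syllables_inj altu u01).
Qed.
End PingPong.

Lemma proj_disjoint S T x : par T x -> (forall i, T i -> ~~ S i) -> proj S x = 1.
Proof.
move=> pT TS; move: x pT; apply: par_ind => [|i g x Ti _ IH].
  exact: proj_one.
by rewrite projM proj_inj (negPf (TS i Ti)) mul1g.
Qed.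

Lemma proj_vertex S T l x : par T x -> (forall i, T i -> S i -> i = l) ->
  exists g : G l, proj S x = inj g.
Proof.
move=> /(par_proj S) pST TS; apply: par1P; apply: par_sub pST => i.
by case/andP=> Si Ti /=; rewrite (TS i Ti Si) eqxx.
Qed.
End Walls.

(** * The cycle *)

Section CycleGraph.
Variable n : nat.
Hypothesis n_ge5 : 5 <= n.
Local Notation adj := (@cycle_adj n).
Local Notation star := (star (@cycle_adj n)).
Implicit Types i j k l : 'Z_n.

(** Here the bound on [n] enters: the values 1, 2, 3, 4 of [m] exclude loops, equal neighbours,
    triangles and squares. *)
Lemma addr_small m i : 0 < m < 5 -> (i + m%:R != i)%R.
Proof.
case/andP=> m0 m5; have n1 : 1 < n by apply: leq_trans n_ge5.
rewrite -[X in _ != X]addr0 (inj_eq (addrI i)).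
apply/negP => /eqP/(congr1 (@nat_of_ord _)); rewrite val_Zp_nat //.
by rewrite modn_small ?(leq_trans m5) // => m_eq0; rewrite m_eq0 in m0.
Qed.

Lemma cycle_adjP i j : reflect (j = i + 1 \/ i = j + 1)%R (adj i j).
Proof. by apply: (iffP orP) => -[/eqP|/eqP]; [left | right | left | right]. Qed.

Lemma cycle_adjC : symmetric adj.
Proof. by move=> i j; rewrite /cycle_adj orbC. Qed.

Lemma cycle_adj_irr : irreflexive adj.
Proof.
by move=> i; apply/cycle_adjP => -[] /esym/eqP; apply/negP/(@addr_small 1).
Qed.

Lemma cycle_starC i j : star i j = star j i.
Proof. by rewrite /star eq_sym cycle_adjC. Qed.

Lemma cycle_starP i j : reflect [\/ j = i, j = i + 1 | i = j + 1]%R (star i j).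
Proof.
apply: (iffP orP) => [[/eqP|/cycle_adjP[]]|[e|e|e]];
  [by constructor 1 | by constructor 2 | by constructor 3 | left; exact/eqP |
   right; apply/cycle_adjP; by left | right; apply/cycle_adjP; by right].
Qed.

Lemma star_far i j k : ~~ star i k -> star i j -> star k j ->
  (j = i + 1 /\ k = j + 1 \/ i = j + 1 /\ j = k + 1)%R.
Proof.
move=> nik ij kj; move: (nik); case/cycle_starP: ij => [e|e|e].
- by rewrite cycle_starC -e kj.
- case/cycle_starP: kj => [e'|e'|e'] _; last by left.
    by case/negP: nik; apply/cycle_starP; constructor 2; rewrite -e'.
  by case/negP: nik; apply/cycle_starP; constructor 1; apply: (addIr 1%R); rewrite -e'.
- case/cycle_starP: kj => [e'|e'|e'] _; first 1 last.
  + by right.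
  + by case/negP: nik; apply/cycle_starP; constructor 1; rewrite e'.
  + by case/negP: nik; apply/cycle_starP; constructor 3; rewrite -e'.
Qed.

Lemma star_meet2 i k j j' : ~~ star i k -> star i j -> star k j ->
  star i j' -> star k j' -> j = j'.
Proof.
move=> nik ij kj ij' kj'.
have four x : x <> (x + 1 + 1 + 1 + 1)%R :> 'Z_n.
  by move=> /esym/eqP; rewrite -!addrA; apply/negP/(@addr_small 4).
have [[e1 e2]|[e1 e2]] := star_far nik ij kj;
  have [[e3 e4]|[e3 e4]] := star_far nik ij' kj'; rewrite ?e1 ?e3 //.
- by case: (four i); rewrite -e1 -e2 -e4 -e3.
- by case: (four k); rewrite -e2 -e1 -e3 -e4.
- by rewrite e2 e4.
Qed.

Lemma neighbours j p q : adj j p -> adj j q -> p != q ->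
  (p = j + 1 /\ j = q + 1 \/ q = j + 1 /\ j = p + 1)%R.
Proof.
move=> /cycle_adjP[e|e] /cycle_adjP[e'|e'] /eqP pq; [|by left|by right|].
  by case: pq; rewrite e e'.
by case: pq; apply: (addIr 1%R); rewrite -e.
Qed.

Lemma neighbours_nadj j p q : adj j p -> adj j q -> p != q -> ~~ star p q.
Proof.
wlog [e e'] : p q / (p = j + 1 /\ j = q + 1)%R => [H|_ _ pq].
  move=> jp jq pq; have [e|e] := neighbours jp jq pq; first exact: H.
  by rewrite cycle_starC; apply: H; rewrite // eq_sym.
apply/negP => /cycle_starP[e1|e1|e1].
- by rewrite e1 eqxx in pq.
- move/eqP: e1; rewrite e e' -!addrA eq_sym; apply/negP; exact: (@addr_small 3).
- move/addIr: (etrans (esym e) e1) => /eqP; rewrite e'; apply/negP; exact: (@addr_small 1).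
Qed.

Lemma neighboursP j p q k : adj j p -> adj j q -> p != q -> adj j k ->
  (k == p) || (k == q).
Proof.
move=> jp jq pq /cycle_adjP[] ek; have [[e e']|[e e']] := neighbours jp jq pq.
- by rewrite ek e eqxx.
- by rewrite ek e eqxx orbT.
- by apply/orP; right; apply/eqP/(addIr 1%R); rewrite -ek.
- by apply/orP; left; apply/eqP/(addIr 1%R); rewrite -ek.
Qed.

Lemma triangle_free i j k : adj i j -> star i k -> star j k -> k = i \/ k = j.
Proof.
move=> ij /orP[/eqP|ik] jk; [by left | right].
by apply/eqP/negPn/negP; rewrite eq_sym => /(neighbours_nadj ij ik)/negP.
Qed.

Lemma star_sub_eq i j k l : adj i j -> adj i k -> j != k ->
  star l i -> star l j -> star l k -> i = l.
Proof.
move=> ij ik jk /orP[/eqP //|li] lj lk.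
have /negP := neighbours_nadj ij ik jk.
rewrite cycle_adjC in li; have /orP[] := neighboursP ij ik jk li => /eqP el.
  by rewrite -el lk.
by rewrite cycle_starC -el lj.
Qed.

Lemma cycle_no_square i k : ~~ star i k ->
  exists l, forall j, star i j -> star k j -> j = l.
Proof.
move=> ik; have [[l [il kl]]|nl] := pselect (exists l, star i l /\ star k l).
  by exists l => j ij kj; exact: star_meet2 ik ij kj il kl.
by exists i => j ij kj; case: nl; exists j.
Qed.

Lemma adj_next i : adj i (i + 1)%R.
Proof. by rewrite /cycle_adj eqxx. Qed.

Lemma adj_prev i : adj i (i - 1)%R.
Proof. by rewrite /cycle_adj subrK eqxx orbT. Qed.

Lemma prev_neq_next i : (i - 1 != i + 1 :> 'Z_n)%R.
Proof.
by rewrite -{2}[i](subrK 1%R) eq_sym -addrA; exact: (@addr_small 2).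
Qed.
End CycleGraph.

(** * Rigidity of automorphisms *)

Lemma morph_conjg (G H : groupType) (f : G -> H) :
  {morph f : x y / x * y} -> {morph f : x y / x ^ y}.
Proof. by move=> fM x y; rewrite /conjg !fM (morph_mulgV fM). Qed.

Section Rigidity.
Variable n : nat.
Hypothesis n_ge5 : 5 <= n.
Variables (G : 'Z_n -> groupType) (D : syllabic (@cycle_adj n) G).
Hypothesis G_nontrivial : forall i, nontrivial (G i).
Local Notation adj := (@cycle_adj n).
Local Notation star := (star (@cycle_adj n)).
Local Notation inj := (inj D).
Implicit Types (i j k l p q : 'Z_n) (x y z : D).

Let no_square := cycle_no_square n_ge5.

(** The retraction onto [G i] sends [inj b ^ x] to a conjugate of [inj b], but kills the subgroup of
    [S] if [i] is outside [S]. *)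
Lemma par_conj_tag S i (b : G i) x : b <> 1 -> par S (inj b ^ x) -> S i.
Proof.
move=> b1 pb; apply/negPn/negP => Si; apply: b1; apply/(inj_eq1 (D := D)).
have : proj D (pred1 i) (inj b ^ x) = 1.
  by apply: proj_disjoint pb _ => j Sj /=; apply: contraNneq Si => <-.
rewrite (morph_conjg (@projM _ _ _ D _)) proj_inj /= eqxx => /eqP.
by rewrite conjg_eq1 => /eqP.
Qed.

(** The star of [l] contains [i] and both its neighbours, which forces [i = l]. If [y] were outside
    the star subgroup, [star_inter] would conjugate the star subgroup of [i] into that of some [k]
    outside the star of [i], and the same argument would give [i = k]. *)
Lemma star_conj_incl i l y :
  (forall x, par (star i) x -> par (star l) (x ^ y)) -> i = l /\ par (star i) y.
Proof.
have tags_sub l' y' : (forall x, par (star i) x -> par (star l') (x ^ y')) -> i = l'.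
  move=> H; have sub j : star i j -> star l' j.
    move=> ij; have [b b1] := G_nontrivial j.
    exact: par_conj_tag b1 (H _ (par_inj D b ij)).
  apply: (star_sub_eq n_ge5 (adj_prev i) (adj_next i) (prev_neq_next n_ge5 i));
    apply: sub; first exact: star_refl.
    exact/adj_star/adj_prev.
  exact/adj_star/adj_next.
move=> H; have il := tags_sub _ _ H; subst l; split=> //.
have [[e [f [pe pf ->]]]|[e [k [pe ki K]]]] := star_inter i i y.
  exact: parM.
have ik : i = k by apply: (tags_sub k e) => x px; apply: K => //; exact: H.
by move: ki; rewrite -ik star_refl.
Qed.

(** * Images of star subgroups under an automorphism *)

Section Automorphism.
Variable f : giso D D.
Let f' := giso_inv f.
Let fM : {morph f : x y / x * y} := @gisoM _ _ f.
Let f'M : {morph f' : x y / x * y} := giso_symM f.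
Let fK : cancel f f' := gisoK f.
Let f'K : cancel f' f := gisoVK f.

(** The star subgroup is the direct product of [G i] and the link subgroup, both nontrivial;
    [star_of_product] applies to their images. *)
Lemma star_into (g : giso D D) i :
  exists z k, forall x, par (star i) x -> par (star k) (g x ^ z).
Proof.
have gM : {morph g : x y / x * y} := @gisoM _ _ g.
have g1 x : g x = 1 -> x = 1.
  by move=> e; apply: (can_inj (gisoK g)); rewrite e (morph_mulg1 gM).
pose A x := exists a : G i, x = g (inj a).
pose B x := exists2 u, par (adj i) u & x = g u.
have [||||||| z [k H]] := @star_of_product _ _ _ D no_square A B.
- by move=> _ _ [a ->] [b ->]; exists (a * b); rewrite injM gM.
- by move=> _ _ [a pa ->] [b pb ->]; exists (a * b); [exact: parM | rewrite gM].
- by move=> _ [a pa ->]; exists a^-1; [exact: parV | rewrite (morph_mulgV gM)].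
- by move=> _ _ [a ->] [u pu ->]; rewrite /commute -!gM (link_commute a pu).
- move=> _ [a ->] [u pu /(can_inj (gisoK g)) e].
  have fa : front D i (inj a) = 1 by rewrite e front_linkE.
  by rewrite front_inj1 in fa; rewrite fa inj_one (morph_mulg1 gM).
- have [a a1] := G_nontrivial i; exists (g (inj a)); first by exists a.
  by move=> /g1/inj_eq1.
- have [a a1] := G_nontrivial (i + 1)%R; exists (g (inj a)).
    by exists (inj a) => //; apply: par_inj; exact: adj_next.
  by move=> /g1/inj_eq1.
exists z, k => x /starP[a [u pu ->]]; rewrite gM conjMg.
by apply: parM; apply: H; [left; exists a | right; exists u].
Qed.

Lemma star_onto i : exists zk : D * 'Z_n,
  forall x, par (star i) x <-> par (star zk.2) (f x ^ zk.1).
Proof.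
have [z [k zk]] := star_into f i; have [y [l yl]] := star_into (giso_sym f) k.
have E x : f' (f x ^ z) ^ y = x ^ (f' z * y).
  by rewrite (morph_conjg f'M) fK conjgM.
have [il pw] : i = l /\ par (star i) (f' z * y).
  by apply: star_conj_incl => x /zk/yl; rewrite -E.
exists (z, k) => x; split=> [/zk //|/yl]; rewrite -il.
rewrite -[giso_sym f _]/(f' _) E => /parJ/(_ (parV pw)).
by rewrite conjgK.
Qed.

Variables (sigma : 'Z_n -> 'Z_n).

Definition star_map i h : Prop :=
  forall x, par (star i) x <-> par (star (sigma i)) (f x ^ h).

Hypothesis star_map_ex : forall i, exists h, star_map i h.

Lemma star_mapM i h s : star_map i h -> par (star (sigma i)) s ->
  star_map i (h * s).
Proof.
move=> ih ps x; rewrite conjgM; split=> [/ih px|px]; first exact: parJ.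
by apply/ih; rewrite -[f x ^ h](conjgK s); apply: parJ => //; exact: parV.
Qed.

Lemma star_mapP i h x :
  star_map i h -> par (star (sigma i)) x -> exists2 y, par (star i) y & x = f y ^ h.
Proof.
move=> ih px; exists (f' (x ^ h^-1)); last by rewrite f'K conjgKV.
by apply/ih; rewrite f'K conjgKV.
Qed.

Lemma star_map_diff i h h' : star_map i h -> star_map i h' ->
  par (star (sigma i)) (h^-1 * h').
Proof.
move=> ih ih'; apply: (proj2 (star_conj_incl (l := sigma i) _)) => x px.
have [y py ->] := star_mapP ih px.
by rewrite -conjgM mulVKg; apply/ih'.
Qed.

(* The star of a neighbour m of l contains a syllable group centralizing G l; its
   preimage would centralize G i and G j, hence lie in both stars. *)
Lemma edge_not_vertex i j h l : adj i j ->
  ~ (forall y, par (star i) y -> par (star j) y -> par (pred1 l) (f y ^ h)).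
Proof.
move=> ij H; have [b b1] := G_nontrivial (l + 1)%R.
have lm := adj_next l; pose v := f' (inj b ^ h^-1).
have fv : f v ^ h = inj b by rewrite f'K conjgKV.
have key k : star i k -> star j k -> par (star k) v.
  move=> ik jk; have [a a1] := G_nontrivial k.
  have /par1P[c ec] := H _ (par_inj D a ik) (par_inj D a jk).
  apply: (proj2 (conj_inj_star (b' := a) a1 _)).
  apply: (can_inj fK); apply: (@conjg_inj _ h).
  rewrite (morph_conjg fM) conjJg fv ec conjgE.
  by rewrite (injC D c b lm) mulKg.
have := H v (key i (star_refl _ _) _) (key j _ (star_refl _ _)).
rewrite (starC D) adj_star // => /(_ isT isT).
rewrite fv -[inj b]conjg1 => /(par_conj_tag b1) /= /eqP lm'.
by move: lm; rewrite lm' cycle_adj_irr.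
Qed.

Lemma star_map_edge i j : adj i j ->
  adj (sigma i) (sigma j) /\ exists h, star_map i h /\ star_map j h.
Proof.
move=> ij; have [z iz] := star_map_ex i; have [z' jz'] := star_map_ex j.
(* Each obstruction below puts the image of the common part of the two star subgroups, up to
   conjugation, in two star subgroups that meet in a vertex group, against [edge_not_vertex]. *)
have vertex h k : (forall y, par (star i) y -> par (star j) y ->
    par (star (sigma i)) (f y ^ h) /\ par (star k) (f y ^ h)) ->
    ~~ star (sigma i) k -> False.
  move=> H /no_square[l lP]; apply: (@edge_not_vertex i j h l ij) => y iy jy.
  have [piy pky] := H y iy jy; apply: par_sub (par_inter piy pky) => m.
  by move=> /andP[/lP H1 /H1 ->] /=; rewrite eqxx.
have [[e [e' [pe pe' ez]]]|[e [k [pe ki K]]]] :=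
    star_inter (sigma i) (sigma j) (z^-1 * z'); last first.
  exfalso; apply: (vertex (z * e) k) => // y /iz iy /jz' jy.
  rewrite conjgM; split; first exact: parJ.
  by apply: K => //; rewrite -conjgM mulVKg.
have iz1 : star_map i (z * e) by exact: star_mapM.
have jz1 : star_map j (z * e).
  have -> : z * e = z' * e'^-1 by rewrite -[z'](mulVKg z) ez !mulgA mulgK.
  by apply: star_mapM => //; exact: parV.
split; last by exists (z * e).
have : star (sigma i) (sigma j).
  apply/negPn/negP; apply: (vertex (z * e)) => y iy jy.
  by split; [apply/iz1 | apply/jz1].
case/orP => [/eqP sji|//].
have [ij' _] : i = j /\ par (star i) (1 : D).
  by apply: star_conj_incl => x /iz1; rewrite conjg1 -sji => /jz1.
by move: ij; rewrite ij' cycle_adj_irr.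
Qed.

Lemma star_meet_adj j p x : adj j p -> par (star j) x -> par (star p) x ->
  par (pred2 p j) x.
Proof.
move=> jp pj pp; apply: par_sub (par_inter pj pp) => k /andP[jk pk] /=.
by have [->|->] := triangle_free n_ge5 jp jk pk; rewrite eqxx ?orbT.
Qed.

(* Letters of the star of j lie in G i, G j or G k; the images of the first two
   kinds are handled by [h1], those of the last kind by [h2]. *)
Lemma star_map_ind i j k h1 h2 (P : D -> Prop) :
  adj j i -> adj j k -> i != k ->
  star_map i h1 -> star_map j h1 -> star_map j h2 -> star_map k h2 -> P 1 ->
  (forall x y, par (pred2 (sigma i) (sigma j)) x -> P y -> P (x * y)) ->
  (forall x y, par (pred2 (sigma k) (sigma j)) x -> P y ->
     P (x ^ (h1^-1 * h2)^-1 * y)) ->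
  forall x, par (star (sigma j)) x -> P x.
Proof.
move=> ji jk ik i1 j1 j2 k2 P1 Pi Pk x /(star_mapP j1)[y py ->] {x}.
have [ai _] := star_map_edge ji; have [ak _] := star_map_edge jk.
move: y py; apply: par_ind => [|m g y jm _ Py].
  by rewrite (morph_mulg1 fM) conj1g.
rewrite fM conjMg; have pj := par_inj D g jm.
have [mi|mk] : star i m \/ m = k.
  case/orP: jm => [/eqP->|/(neighboursP ji jk ik)/orP[/eqP->|/eqP->]].
  - by left; rewrite (starC D) adj_star.
  - by left; exact: star_refl.
  - by right.
- by apply: Pi => //; apply: star_meet_adj ai _ _; [apply/j1 | apply/i1/par_inj].
have -> : f (inj g) ^ h1 = (f (inj g) ^ h2) ^ (h1^-1 * h2)^-1.
  by rewrite -conjgM invgM invgK mulVKg.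
apply: Pk => //; apply: star_meet_adj ak _ _; [exact/j2 | apply/k2/par_inj].
by rewrite mk star_refl.
Qed.

Lemma star_map_corner i j k : adj j i -> adj j k -> i != k ->
  sigma i != sigma k /\ exists h, [/\ star_map i h, star_map j h & star_map k h].
Proof.
move=> ji jk ik.
have [ai [h1 [j1 i1]]] := star_map_edge ji.
have [ak [h2 [j2 k2]]] := star_map_edge jk.
pose u := h1^-1 * h2; have pu : par (star (sigma j)) u := star_map_diff j1 j2.
have ind := star_map_ind ji jk ik i1 j1 j2 k2.
(* If they agreed, the projection to another neighbour [m] of [sigma j] would kill the generators of
   the star subgroup of [sigma j], which contains [G m]. *)
have pqn : sigma i != sigma k.
  apply/negP => /eqP ski.
  have [m [jm im]] : exists m, adj (sigma j) m /\ m != sigma i.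
    have [e|e] := eqVneq (sigma j - 1)%R (sigma i); last first.
      by exists (sigma j - 1)%R; split; first exact: adj_prev.
    exists (sigma j + 1)%R; rewrite -e eq_sym prev_neq_next //; split=> //.
    exact: adj_next.
  have [mi mj] : ~~ star (sigma i) m /\ m != sigma j.
    split; first by rewrite (starC D); exact (neighbours_nadj n_ge5 jm ai im).
    by apply: contraTneq jm => ->; rewrite cycle_adj_irr.
  have mproj x : par (pred2 (sigma i) (sigma j)) x -> proj D (pred1 m) x = 1.
    move=> px; apply: proj_disjoint px _ => r /= /orP[]/eqP->; rewrite eq_sym //.
  have prM := @projM _ _ _ D (pred1 m).
  have [b b1] := G_nontrivial m; apply: b1; apply/(inj_eq1 (D := D)).
  have : proj D (pred1 m) (inj b) = 1.
    apply: (ind (fun x => proj D (pred1 m) x = 1)).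
    - exact: proj_one.
    - by move=> x y /mproj px py; rewrite prM px py mulg1.
    - move=> x y; rewrite -ski => /mproj px py.
      by rewrite prM (morph_conjg prM) px py conj1g mulg1.
    - exact/par_inj/adj_star.
  by rewrite proj_inj /= eqxx.
split=> //; set p := sigma i in ai pqn *; set q := sigma k in ak pqn *.
have npq := neighbours_nadj n_ge5 ai ak pqn.
have jp : sigma j != p by apply: contraTneq ai => ->; rewrite cycle_adj_irr.
have jq : sigma j != q by apply: contraTneq ak => ->; rewrite cycle_adj_irr.
have [h [v pv ev]] := starP pu.
have pv2 : par (pred2 p q) v.
  by apply: par_sub pv => m jm; exact (neighboursP ai ak pqn jm).
have prM := @projM _ _ _ D (pred2 p q).
have eu : proj D (pred2 p q) u = v.
  by rewrite ev prM proj_inj /= (negPf jp) (negPf jq) mul1g.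
(* Projected to the free product of [G p] and [G q], the mismatch [u] becomes [v], and [ind] says
   that [G p] and the conjugate of [G q] by [v] generate. *)
have [||||a [b evab]] := @generating_pair _ _ _ D p q _ _ v pv2.
- exact/eqP.
- by apply: contra npq => ?; exact: adj_star.
- by have [b b1] := G_nontrivial q; exists b.
- move=> K K1 Kp Kq x px; rewrite -px.
  apply: (ind (fun x => K (proj D (pred2 p q) x))).
  + by rewrite proj_one.
  + move=> {px}x y px Ky; have [|g eg] := @proj_vertex _ _ _ D (pred2 p q) _ p x px.
      by move=> r /orP[/eqP-> //|/eqP->] /=; rewrite (negPf jp) (negPf jq).
    by rewrite prM eg; exact: Kp.
  + move=> {px}x y px Ky; have [|g eg] := @proj_vertex _ _ _ D (pred2 p q) _ q x px.
      by move=> r /orP[/eqP-> //|/eqP->] /=; rewrite (negPf jp) (negPf jq).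
    rewrite prM (morph_conjg prM) (morph_mulgV prM) -/u eu eg conjgE invgK.
    by rewrite -!mulgA; exact: Kq.
  + apply: par_sub px => m /orP[] /eqP->; exact: adj_star.
exists (h1 * inj a); split.
- by apply: star_mapM => //; apply: par_inj; exact: star_refl.
- by apply: star_mapM => //; apply: par_inj; exact: adj_star.
(* Here [u = h a b], and [h], from the group of [sigma j], commutes with [a]. *)
have -> : h1 * inj a = h2 * (inj b^-1 * inj h^-1).
  rewrite -[h2](mulVKg h1) -/u ev evab !injV -!mulgA.
  rewrite mulVKg; congr (_ * _); have /= cha := injC D h a ai.
  by rewrite mulgA cha mulgK.
apply: star_mapM => //; apply: parM; apply: par_inj; first exact: star_refl.
by rewrite (starC D) adj_star.
Qed.

(** Edges go to edges and [star_map_corner] forbids turning back, so the direction [e] of the first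
    step is kept. The induction carries two consecutive values. *)
Lemma sigma_affine : exists e : 'Z_n,
  (e = 1 \/ e = -1)%R /\ forall i, (sigma i = sigma 0 + e * i)%R.
Proof.
have [e [e1 e0]] : exists e : 'Z_n, (e = 1 \/ e = -1)%R /\ (sigma 1 = sigma 0 + e)%R.
  have [/orP[/eqP s1|/eqP s1] _] := star_map_edge (adj_next 0%R).
    by exists 1%R; rewrite -s1 add0r; split; first by left.
  by exists (-1)%R; rewrite s1 add0r addrK; split; first by right.
exists e; split=> // i.
suff key m : (sigma m%:R = sigma 0 + e * m%:R)%R /\
    (sigma (m%:R + 1) = sigma 0 + e * (m%:R + 1))%R.
  by have [+ _] := key i; rewrite natr_Zp.
elim: m => [|m [IH1 IH2]]; first by rewrite mulr0n mulr0 addr0 add0r mulr1.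
rewrite -natr1; split=> //.
have := @star_map_corner (m%:R)%R (m%:R + 1)%R (m%:R + 1 + 1)%R.
have a1 : adj (m%:R + 1 : 'Z_n)%R (m%:R)%R by rewrite /cycle_adj eqxx orbT.
have a2 := adj_next (m%:R + 1 : 'Z_n)%R.
have ne : (m%:R != m%:R + 1 + 1 :> 'Z_n)%R.
  by have := prev_neq_next n_ge5 (m%:R + 1)%R; rewrite addrK.
move=> /(_ a1 a2 ne)[sne _]; have [a3 _] := star_map_edge a2.
move: a3 sne; rewrite IH1 IH2 /cycle_adj => /orP[] /eqP.
  case: e1 => -> ->; rewrite !mulrDr ?mulr1 ?mul1r ?addrA // ?mulN1r.
  by rewrite subrK eqxx.
move=> E; have {E} -> : (sigma (m%:R + 1 + 1) = sigma 0 + e * (m%:R + 1) - 1)%R.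
  by rewrite E addrK.
case: e1 => ->; rewrite !mulrDr ?mulr1 ?mul1r ?addrA ?mulN1r // addrK.
by rewrite eqxx.
Qed.

Lemma sigma_inj : injective sigma.
Proof.
have [e [e1 se]] := sigma_affine; move=> i j; rewrite (se i) (se j) => /addrI.
by case: e1 => ->; [rewrite !mul1r | rewrite !mulN1r => /oppr_inj].
Qed.

Lemma sigma_adj i j : adj (sigma i) (sigma j) = adj i j.
Proof.
have [e [e1 se]] := sigma_affine.
have E k l : (sigma k == sigma l + e)%R = (k == l + 1)%R.
  rewrite (se k) (se l) -addrA (inj_eq (addrI _)) -[X in (_ + X)%R]mulr1 -mulrDr.
  by case: e1 => ->; [rewrite !mul1r | rewrite !mulN1r (inj_eq oppr_inj)].
rewrite /cycle_adj; case: e1 => ee; first by rewrite -ee !E ee.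
have E' k l : (sigma k == sigma l + 1)%R = (l == k + 1)%R.
  by rewrite -[RHS]E ee [RHS]eq_sym subr_eq.
by rewrite !E' orbC.
Qed.


Lemma star_map_chamber : exists d, forall i, star_map i d.
Proof.
have /boolp.choice[c cP] : forall i, exists h,
    [/\ star_map (i - 1)%R h, star_map i h & star_map (i + 1)%R h].
  by move=> i; case: (star_map_corner (adj_prev i) (adj_next i) (prev_neq_next n_ge5 i)).
(* The conjugators [c (i - 1)] and [c i] differ by an element of the star subgroups of both
   [sigma (i - 1)] and [sigma i], hence by a product of one element of each vertex group; [d i] is
   the point between the two factors. *)
pose edge i d := exists g : G (sigma i), d = c i * inj g.
have /boolp.choice[d dP] : forall i, exists d, edge (i - 1)%R d /\ edge i d.
  move=> i; have [_ p1] := cP (i - 1)%R; rewrite subrK => i1; have [p2 i2 _] := cP i.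
  have ai : adj (sigma (i - 1)%R) (sigma i) by rewrite sigma_adj cycle_adjC adj_prev.
  have [x [u pu e]] := starP (star_map_diff p1 p2).
  have pu' : par (star (sigma i)) u.
    have := star_map_diff i1 i2; rewrite e; apply: parMl; apply: par_inj.
    by rewrite (starC D) adj_star.
  have /par1P[y ey] : par (pred1 (sigma i)) u.
    apply: par_sub (par_inter pu pu') => k /andP[ak sk] /=.
    have [ek|-> //] := triangle_free n_ge5 ai (adj_star ak) sk.
    by move: ak; rewrite ek cycle_adj_irr.
  exists (c (i - 1)%R * inj x); split; first by exists x.
  exists y^-1; rewrite injV -ey -[c i](mulVKg (c (i - 1)%R)) e.
  by rewrite -!mulgA mulgV mulg1.
have step i : exists g : G (sigma i), d (i + 1)%R = d i * inj g.
  have [_ [g ->]] := dP i; have [[h e] _] := dP (i + 1)%R.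
  rewrite addrK in h e; exists (g^-1 * h).
  by rewrite e injM injV -mulgA mulVKg.
(* Only the [j]-th step survives the retraction onto [G (sigma j)], as [sigma] is injective. The
   other [n.-1] steps lead from [j + 1] back to [j], so [g] is trivial. *)
have dconst j : d (j + 1)%R = d j.
  have [g eg] := step j; pose P := proj D (pred1 (sigma j)).
  have PM : {morph P : x y / x * y} := @projM _ _ _ D _.
  have Pstep i : i != j -> P (d (i + 1)%R) = P (d i).
    move=> ij; have [h ->] := step i; rewrite PM [P (inj h)]proj_inj /=.
    by rewrite (inj_eq sigma_inj) (negPf ij) mulg1.
  have round m : m < n -> P (d (j + 1 + m%:R)%R) = P (d (j + 1)%R).
    elim: m => [|m IH] mn; first by rewrite mulr0n addr0.
    rewrite -natr1 addrA (Pstep (j + 1 + m%:R)%R) ?IH //; first exact: ltnW.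
    rewrite -[X in _ != X]addr0 -addrA (inj_eq (addrI j)) addrC natr1.
    apply/negP => /eqP/(congr1 (@nat_of_ord _)); rewrite val_Zp_nat; last first.
      exact: leq_trans n_ge5.
    by rewrite modn_small.
  have := round n.-1; rewrite -addrA [(1 + _)%R]addrC natr1 prednK; last first.
    exact: leq_trans n_ge5.
  rewrite pchar_Zp ?addr0; last exact: leq_trans n_ge5.
  move=> /(_ (leqnn _)); rewrite eg PM [P (inj g)]proj_inj /= eqxx.
  by rewrite -{1}[P (d j)]mulg1 => /mulgI <-; rewrite mulg1.
exists (d 0%R) => i.
suff -> : d 0%R = d i.
  have [_ [g ->]] := dP i; have [_ ci _] := cP i.
  by apply: star_mapM => //; apply: par_inj; exact: star_refl.
suff key m : d (m%:R)%R = d 0%R by rewrite -[i]natr_Zp key.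
by elim: m => // m IH; rewrite -natr1 dconst.
Qed.

(** By [star_meet2], only [j] is in both stars; star subgroups thus determine the vertex groups. *)
Lemma par_vertexP j p q x : adj j p -> adj j q -> p != q ->
  par (pred1 j) x <-> par (star p) x /\ par (star q) x.
Proof.
move=> jp jq pq; have pj : star p j by rewrite (starC D) adj_star.
have qj : star q j by rewrite (starC D) adj_star.
split=> [pjx|[px qx]].
  by split; apply: par_sub pjx => k /eqP->.
apply: par_sub (par_inter px qx) => k /andP[pk qk]; apply/eqP.
exact (star_meet2 n_ge5 (neighbours_nadj n_ge5 jp jq pq) pk qk pj qj).
Qed.

Lemma star_map_vertex : exists d, forall i x,
  par (pred1 i) x <-> par (pred1 (sigma i)) (f x ^ d).
Proof.
have [d dP] := star_map_chamber; exists d => i x.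
have [ap an] := (adj_prev i, adj_next i).
rewrite (par_vertexP x ap an (prev_neq_next n_ge5 i)) (dP (i - 1)%R x) (dP (i + 1)%R x).
apply: iff_sym; apply: par_vertexP; rewrite ?sigma_adj //.
by rewrite (inj_eq sigma_inj) prev_neq_next.
Qed.
End Automorphism.

Theorem automorphism_vertex (f : giso D D) : exists sigma : 'Z_n -> 'Z_n,
  [/\ injective sigma, forall i j, adj (sigma i) (sigma j) = adj i j &
    exists d, forall i x,
      par (pred1 i) x <-> par (pred1 (sigma i)) (f x ^ d)].
Proof.
have /boolp.choice[zs zsP] := star_onto f.
have ex i : exists h, star_map f (fun i => (zs i).2) i h.
  by exists (zs i).1; exact: zsP.
exists (fun i => (zs i).2); split.
- exact: sigma_inj ex.
- exact: sigma_adj ex.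
- exact: star_map_vertex ex.
Qed.
End Rigidity.

(** * The outer automorphism group *)

Lemma bijective_isomorphic (G H : groupType) (f : G -> H) :
  {morph f : x y / x * y} -> (forall x, f x = 1 -> x = 1) ->
  (forall y, exists x, f x = y) -> isomorphic G H.
Proof.
move=> fM f1 /boolp.choice[g gK].
have f_inj : injective f.
  move=> x y e; apply/divg1_eq/f1.
  by rewrite fM (morph_mulgV fM) e mulgV.
by constructor; exists f g => // x; apply: f_inj; rewrite gK.
Qed.

Section OuterAutomorphisms.
Variable n : nat.
Hypothesis n_ge5 : 5 <= n.
Variables (G : 'Z_n -> groupType) (Theta : iso_system G).
Local Notation adj := (@cycle_adj n).
Local Notation Gam := (cyclic_product G).
Local Notation SD := (semidirect (sym_act adj Theta)).

Let D : syllabic adj G := gp_syllabic G (@cycle_adjC n) (cycle_adj_irr n_ge5).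

Definition sym_isom_to (s : SymGroup adj G) i : isomorphic (G i) (G (s i)) :=
  isomorphic_sym (sym_isom s i).

(** First the permutation, through [theta], then the local automorphism at the new vertex: this
    order matches [sd_mul]. *)
Definition sd_gen (x : SD) i (g : G i) : Gam :=
  gp_inj adj (sd_left x (sd_right x i)
    (theta Theta (sym_isom_to (sd_right x) i) g)).

Lemma sd_genM x i : {morph @sd_gen x i : g h / g * h}.
Proof. by move=> g h; rewrite /sd_gen !gisoM gp_injM. Qed.

Lemma sd_genC x i j (g : G i) (h : G j) :
  adj i j -> commute (sd_gen x g) (sd_gen x h).
Proof. by move=> ij; apply: gp_inj_commute; rewrite sym_adj. Qed.

Definition sd_map (x : SD) : Gam -> Gam := gp_lift (@sd_gen x).

Lemma sd_mapM x : {morph sd_map x : y z / y * z}.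
Proof. exact: gp_liftM (sd_genM x) (@sd_genC x). Qed.

Lemma sd_mapE (x : SD) i j (p : isomorphic (G i) (G j)) (g : G i) :
  sd_right x i = j ->
  sd_map x (gp_inj adj g) = gp_inj adj (sd_left x j (theta Theta p g)).
Proof.
move=> e; subst j; rewrite /sd_map (gp_liftE (sd_genM x) (@sd_genC x)).
by rewrite /sd_gen (Prop_irrelevance p (sym_isom_to (sd_right x) i)).
Qed.

Lemma morph_eq_gen (f f' : Gam -> Gam) :
  {morph f : x y / x * y} -> {morph f' : x y / x * y} ->
  (forall i (g : G i), f (gp_inj adj g) = f' (gp_inj adj g)) -> f =1 f'.
Proof.
move=> fM f'M e; apply: gp_inj_ind => [|i g x IH].
  by rewrite (morph_mulg1 fM) (morph_mulg1 f'M).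
by rewrite fM f'M e IH.
Qed.

Lemma sd_map1 : sd_map 1 =1 id.
Proof.
apply: morph_eq_gen => // [|i g]; first exact: sd_mapM.
have p : isomorphic (G i) (G i) by exact: (inhabits (giso_id _)).
by rewrite (sd_mapE p) ?theta_id //=; apply: perm1.
Qed.

Lemma sd_map_comp (x y : SD) : sd_map (x * y) =1 sd_map x \o sd_map y.
Proof.
apply: morph_eq_gen => [|a b|i g]; first exact: sd_mapM.
  by rewrite /= !sd_mapM.
have p := sym_isom_to (sd_right y) i.
have q := sym_isom_to (sd_right x) (sd_right y i).
have r := isomorphic_trans p q.
rewrite /= (@sd_mapE y _ _ p) // (@sd_mapE x _ _ q) //.
rewrite (@sd_mapE (x * y) _ _ r); last exact: permM.
congr (gp_inj adj _); set k := sd_right x _.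
have -> : sd_left (x * y) k =
    giso_comp (sd_left x k) (sym_act_fun Theta (sd_right x) (sd_left y) k) by [].
rewrite (sym_act_perm _ _ q) /=.
by rewrite -(theta_comp Theta p q r) gisoK.
Qed.

Lemma sd_mapK x : cancel (sd_map x) (sd_map x^-1).
Proof. by move=> z; rewrite -[LHS]sd_map_comp mulVg sd_map1. Qed.

Lemma sd_mapVK x : cancel (sd_map x^-1) (sd_map x).
Proof. by move=> z; rewrite -[LHS]sd_map_comp mulgV sd_map1. Qed.

Definition sd_aut (x : SD) : AutGroup Gam :=
  GIso (sd_mapM x) (sd_mapK x) (sd_mapVK x).

Definition sd_out (x : SD) : OutGroup Gam := quot_proj (InnGroup Gam) (sd_aut x).

Lemma sd_outM : {morph sd_out : x y / x * y}.
Proof.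
move=> x y; rewrite /sd_out -(quot_projM (InnGroup Gam)); congr quot_proj.
by apply: gisoP => z; exact: sd_map_comp.
Qed.

Hypothesis G_nontrivial : forall i : 'Z_n, nontrivial (G i).

Lemma par_star_all (y : D) : (forall i, par (star adj i) y) -> y = 1.
Proof.
move=> sy; have vy i : par (pred1 i) y.
  by apply/(par_vertexP n_ge5 y (adj_prev i) (adj_next i) (prev_neq_next n_ge5 i)).
rewrite -(vy 1%R); apply: proj_disjoint (vy 0%R) _ => i /eqP->.
apply/negP => /eqP e; have := adj_next (0 : 'Z_n)%R.
by rewrite add0r -e (cycle_adj_irr n_ge5).
Qed.

(** The conjugation sends a nontrivial element of each [G i] into a vertex group. By
    [conj_inj_star], [sd_right x] fixes [i] and the conjugator is in every star subgroup, hence 1 by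
    [par_star_all]. *)
Lemma sd_out1 x : sd_out x = 1 -> x = 1.
Proof.
rewrite /sd_out -(morph_mulg1 (quot_projM (InnGroup Gam))) => /esym.
move=> /quot_proj_eq; rewrite invg1 mul1g => -[g gP].
have gE z : sd_map x z = z ^ g^-1 by rewrite conjgE invgK mulgA; exact: gP.
have fixi i : sd_right x i = i /\ par (star adj i) (g^-1 : D).
  have [b b1] := G_nontrivial i.
  have := gE (gp_inj adj b); rewrite (sd_mapE (sym_isom_to (sd_right x) i)) //.
  by move/esym/(conj_inj_star (D := D) b1) => [<- ?].
have g1 : g^-1 = 1 by apply: (@par_star_all g^-1) => i; have [] := fixi i.
case: x gE fixi {gP} => a s /= gE fixi.
congr Semidirect; last by apply: symP => i /=; rewrite perm1; have [] := fixi i.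
apply: functional_extensionality_dep => i; apply: gisoP => b.
have p : isomorphic (G i) (G i) by exact: (inhabits (giso_id _)).
have := gE (gp_inj adj b); rewrite (sd_mapE p) /=; last by have [] := fixi i.
rewrite theta_id g1 conjg1 => /(congr1 (front D i)).
by rewrite !(front_inj1 D).
Qed.

Lemma sd_out_onto (y : OutGroup Gam) : exists x, sd_out x = y.
Proof.
have [f ->] := quot_projP y.
have [sigma [sigma_inj sigma_adj [d dP]]] :=
  automorphism_vertex n_ge5 G_nontrivial (f : giso D D).
pose f1 z := f z ^ d; pose f2 z := giso_inv f (z ^ d^-1).
have f1M : {morph f1 : a b / a * b} by move=> a b; rewrite /f1 gisoM conjMg.
have f2K : cancel f2 f1 by move=> z; rewrite /f1 /f2 gisoVK conjgKV.
have f1K : cancel f1 f2 by move=> z; rewrite /f1 /f2 conjgK gisoK.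
have f1E i k (g : G i) : sigma i = k ->
    f1 (gp_inj adj g) = gp_inj adj (front D k (f1 (gp_inj adj g))).
  move=> e; have /dP : par (pred1 i) (inj D g) by apply: par_inj; rewrite /= eqxx.
  rewrite e => /par1P[h eh]; rewrite -[f1 _]/(f (inj D g) ^ d) eh.
  by rewrite (front_inj1 D).
have f2E i k (g : G k) : sigma i = k ->
    f2 (gp_inj adj g) = gp_inj adj (front D i (f2 (gp_inj adj g))).
  move=> e; have /par1P[h eh] : par (pred1 i) (f2 (gp_inj adj g) : D).
    apply/dP; rewrite -[_ ^ d]/(f1 _) f2K e.
    by apply: (par_inj D); rewrite /= eqxx.
  by rewrite eh (front_inj1 D).
have beta i k : sigma i = k -> {b : giso (G i) (G k) |
    forall g, f1 (gp_inj adj g) = gp_inj adj (b g)}.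
  move=> e; pose b (g : G i) := front D k (f1 (gp_inj adj g)).
  pose b' (g : G k) := front D i (f2 (gp_inj adj g)).
  have bM : {morph b : g h / g * h}.
    move=> g h; rewrite /b gp_injM f1M (f1E i k g e) (f1E i k h e).
    by rewrite -gp_injM !(front_inj1 D).
  have bK : cancel b b'.
    by move=> g; rewrite /b' /b -(f1E i k g e) f1K (front_inj1 D).
  have b'K : cancel b' b.
    by move=> g; rewrite /b' /b -(f2E i k g e) f2K (front_inj1 D).
  by exists (GIso bM bK b'K) => g; exact: f1E.
pose s0 := perm sigma_inj.
have s0_adj i j : adj (s0 i) (s0 j) = adj i j by rewrite !permE.
have s0_isom i : isomorphic (G (s0 i)) (G i).
  by apply: isomorphic_sym; have [b _] := beta i (s0 i) (esym (permE _ _)); exists.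
pose s : SymGroup adj G := MkSym s0_adj s0_isom.
pose t k := (s0^-1)%g k.
have tK k : sigma (t k) = k by rewrite -[sigma _](permE sigma_inj) permKV.
have q k : isomorphic (G k) (G (t k)).
  by apply: isomorphic_sym; have [b _] := beta _ _ (tK k); exists.
(* As [sd_gen] first applies [theta] from [t k] to [k], the component at [k] starts by undoing
   it. *)
pose a : aut_product G := fun k => giso_comp (sval (beta _ _ (tK k))) (theta Theta (q k)).
exists (Semidirect (sym_act adj Theta) a s).
apply/esym/quot_proj_eq; exists (giso_inv f d)^-1 => z.
have E : sd_map (Semidirect (sym_act adj Theta) a s) =1 f1.
  apply: morph_eq_gen => // [|i g]; first exact: sd_mapM.
  have [k ek] : exists k, s i = k by exists (s i).
  have p : isomorphic (G i) (G k) by rewrite -ek; exact: sym_isom_to.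
  have ei : t k = i by rewrite /t -ek permK.
  subst i; rewrite (sd_mapE p) //= -(svalP (beta _ _ (tK k))).
  have r : isomorphic (G (t k)) (G (t k)) by exact: (inhabits (giso_id _)).
  by rewrite (theta_comp Theta p (q k) r) theta_id.
rewrite -[LHS]/(giso_inv f (sd_map _ z)) E /f1.
rewrite (morph_conjg (giso_symM f)) gisoK conjgE invgK mulgA //.
Qed.
End OuterAutomorphisms.

Theorem corollaryB (n : nat) (n_ge5 : 5 <= n) (G : 'Z_n -> groupType)
    (G_nontrivial : forall i : 'Z_n, nontrivial (G i))
    (Theta : iso_system G) :
  isomorphic (OutGroup (cyclic_product G))
             (semidirect (sym_act (@cycle_adj n) Theta)).
Proof.
apply: isomorphic_sym; apply: (@bijective_isomorphic _ _ (@sd_out n G Theta)).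
- exact: sd_outM.
- exact (sd_out1 n_ge5 (Theta := Theta) G_nontrivial).
- exact (sd_out_onto n_ge5 Theta G_nontrivial).
Qed.
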